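(* Let $\boldsymbol\nu=(\nu,\lambda,\rho,\nu^\infty)\in\mathbf Y^2(\Omega;E)$ be an $\mathcal A$-free two-scale* Young measure and let $h\in C(Z\times E)\cap\mathbf R^2(\Omega;E)$ be an integrand that is convex in its second argument, that is, $h(\xi,\cdot)$ is convex for all $\xi\in Z$. Then, for all regular points $x\in\mathrm{Reg}_{\boldsymbol\nu}(\overline\Omega)$ the following inequalities hold: (i) at $\mathscr L^d_Z$-almost every $\xi$ in $Z$, $$h\Big(\xi,\frac{d[\![\boldsymbol\nu]\!]_x}{d\mathscr L^d}(\xi)\Big)\le\frac{d[\![h,\boldsymbol\nu]\!]_x}{d\mathscr L^d}(\xi);$$ (ii) and, at $\rho_x^s$-almost every $\xi$ in $Z$, $$h^\infty\Big(\xi,\frac{d[\![\boldsymbol\nu]\!]_x}{d\rho_x^s}(\xi)\Big)\le\frac{d[\![h^\infty,\boldsymbol\nu]\!]_x}{d\rho_x^s}(\xi).$$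
   Context: $\Omega\subset\mathbb R^d$ is open and bounded with $\mathscr L^d(\partial\Omega)=0$; $Z=\mathbb T^d=\mathbb R^d/\mathbb Z^d$ with Lebesgue measure $\mathscr L^d_Z$ (also written $d\xi$); $E,F$ are finite-dimensional Euclidean spaces; $\mathbb B_E$ is the open unit ball of $E$. $\mathcal A=\sum_{|\alpha|=k}A_\alpha\partial^\alpha$, $A_\alpha\in\mathrm{Lin}(E;F)$, is a homogeneous constant-coefficient operator of order $k$ on $\mathbb R^d$. $\langle g,\sigma\rangle=\int g\,d\sigma$. A two-scale* Young measure is a four-tuple $\boldsymbol\nu=(\nu,\lambda,\rho,\nu^\infty)$ where: (i) $(x,\xi)\mapsto\nu_{x,\xi}$ is a weak-* measurable (w.r.t. Lebesgue measure) map from $\overline\Omega\times Z$ to $\mathrm{Prob}(E)$ with $(x,\xi)\mapsto\int_E|z|\,d\nu_{x,\xi}(z)$ integrable; (ii) $\lambda$ is a bounded positive measure on $\overline\Omega$, with Lebesgue decomposition $\lambda=\lambda^{ac}\mathscr L^d+\lambda^s$; (iii) $x\mapsto\rho_x$ is a weak-* $\lambda$-measurable map from $\overline\Omega$ to $\mathrm{Prob}(Z)$; (iv) $(x,\xi)\mapsto\nu^\infty_{x,\xi}$ is a weak-* $(\lambda\otimes\rho_x)$-measurable map to $\mathrm{Prob}(\partial\mathbb B_E)$. The set of these is $\mathbf Y^2(\Omega;E)$. Generation: $\mathbf E^2(\Omega;E)$ is the set of $f\in C(\Omega\times Z\times E)$ such that $(Tf)(x,\xi,\hat z)=(1-|\hat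 z|)f(x,\xi,\hat z/(1-|\hat z|))$ extends continuously to $\overline{\Omega\times Z\times\mathbb B_E}$; then the strong recession function $f^\infty(x,\xi,z)=\lim_{x'\to x,\xi'\to\xi,t\to\infty}f(x',\xi',tz)/t$ exists. $(\mu_\varepsilon)\subset\mathcal M(\Omega;E)$, $\varepsilon\searrow0$, generates $\boldsymbol\nu$ if for all $f\in\mathbf E^2(\Omega;E)$ $$\int_\Omega f(x,x/\varepsilon,\mu_\varepsilon^{ac})\,dx+\int_\Omega f^\infty(x,x/\varepsilon,(\mu_\varepsilon)_s)\,d|\mu_\varepsilon^s|\to\int_\Omega\int_Z\langle f(x,\xi,\cdot),\nu_{x,\xi}\rangle\,d\xi\,dx+\int_{\overline\Omega}\int_Z\langle f^\infty(x,\xi,\cdot),\nu^\infty_{x,\xi}\rangle\,d\rho_x(\xi)\,d\lambda(x),$$ where $\mu=\mu^{ac}\mathscr L^d+\mu_s|\mu^s|$ is the Radon–Nikodým–Lebesgue decomposition. $\boldsymbol\nu$ is $\mathcal A$-free (for a fixed $1<p<\frac d{d-1}$) if there are $\varepsilon\searrow0$ and $(\mu_\varepsilon)\subset\mathcal M(\Omega;E)$ generating $\boldsymbol\nu$ with $\mathcal A\mu_\varepsilon\to0$ strongly in $W^{-k,p}(\Omega)$. $\mathbf R^2(\Omega;E)$ is the class of $f\in C(\Omega\times Z\times E)$ possessing a strong recession function, i.e. with $f^\infty\equiv f^\#\equiv f_\#$, where $f^\#$ and $f_\#$ are the limsup and liminf of $f(x',\xi',tz)/t$ as $x'\to x$,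 $\xi'\to\xi$, $t\to\infty$. Functions $h\in C(Z\times E)$ are regarded as integrands independent of $x$. Regular points: the Radon–Nikodym decomposition of $\lambda$ gives a partition of $\overline\Omega$ into a set of regular points $\mathrm{Reg}_{\boldsymbol\nu}(\overline\Omega)$ and a set of singular points $\mathrm{Sing}_{\boldsymbol\nu}=\{x\in\overline\Omega:\frac{d\mathscr L^d}{d|\lambda^s|}(x)=0\}$, with $\mathscr L^d(\mathrm{Sing}_{\boldsymbol\nu})=\lambda^s(\mathrm{Reg}_{\boldsymbol\nu}(\overline\Omega))=0$. Second-scale barycenters at regular points $x$: for Borel $V\subset Z$, $$[\![\boldsymbol\nu]\!]_x(V)=\int_V\langle\mathrm{id}_E,\nu_{x,\xi}\rangle d\xi+\lambda^{ac}(x)\int_V\langle\mathrm{id}_{\partial\mathbb B_E},\nu^\infty_{x,\xi}\rangle d\rho_x(\xi),$$ $$[\![g,\boldsymbol\nu]\!]_x(V)=\int_V\langle g(\xi,\cdot),\nu_{x,\xi}\rangle d\xi+\lambda^{ac}(x)\int_V\langle g^\infty(\xi,\cdot),\nu^\infty_{x,\xi}\rangle d\rho_x(\xi)\qquad(g=h\text{ or }g=h^\infty).$$ $\rho_x^s$ is the part of $\rho_x$ singular with respect to Lebesgue measure on $Z$; $\frac{d\,\cdot}{d\mathscr L^d}$ and $\frac{d\,\cdot}{d\rho_x^s}$ denote Radon–Nikodym densities.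
   Formalization: The inequalities are stated at regular points x where the slice of ν at x is weak-* measurable in ξ with finite first moment (true for a.e. x), since ν is only determined up to null sets and the second-scale barycenters need not exist at exceptional points. *)

(* Defs.v *)
From HB Require Import structures.
From mathcomp Require Import all_boot all_order all_algebra.
From mathcomp Require Import generic_quotient.
From mathcomp Require Import all_classical all_reals all_analysis.
From mathcomp Require Import measurable_realfun.
Set Implicit Arguments.
Unset Strict Implicit.
Unset Printing Implicit Defensive.
Import Order.TTheory GRing.Theory Num.Theory.
Import numFieldNormedType.Exports.
Local Open Scope classical_set_scope.
Local Open Scope ring_scope.

Section borel_matrix.
Context (R : realType) (m n : nat).
HB.instance Definition _ := @isMeasurable.Build default_measure_display
  'M[R]_(m, n) <<s @open 'M[R]_(m, n) >> (@sigma_algebra0 _ setT _)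
  (@sigma_algebraC _ _) (@sigma_algebra_bigcup _ setT _).
End borel_matrix.

Section torus.
Context (R : realType) (d : nat).

Definition torus_rel_ (x y : 'rV[R]_d) :=
  [forall i, x ord0 i - y ord0 i \is a Num.int].

Lemma torus_rel_refl : reflexive torus_rel_.
Proof. by move=> x; apply/forallP => i; rewrite subrr rpred0. Qed.

Lemma torus_rel_sym : symmetric torus_rel_.
Proof. by move=> x y; apply: eq_forallb => i; rewrite -rpredN opprB. Qed.

Lemma torus_rel_trans : transitive torus_rel_.
Proof.
move=> y x z /forallP xy /forallP yz; apply/forallP => i.
by rewrite -(subrKA (y ord0 i)) rpredD.
Qed.

Definition torus_rel :=
  EquivRel torus_rel_ torus_rel_refl torus_rel_sym torus_rel_trans.

Definition torus := {eq_quot torus_rel}%qT.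
HB.instance Definition _ := Topological.copy torus (quotient_topology torus).
HB.instance Definition _ := Quotient.on torus.
HB.instance Definition _ := isPointed.Build torus (\pi_torus 0)%qT.
HB.instance Definition _ := @isMeasurable.Build default_measure_display
  torus <<s @open torus >> (@sigma_algebra0 _ setT _)
  (@sigma_algebraC _ _) (@sigma_algebra_bigcup _ setT _).

Definition torus_proj (x : 'rV[R]_d) : torus := (\pi_torus x)%qT.
End torus.

Section lebesgue_rV.
Context (R : realType).

Lemma borel_open m n (U : set 'M[R]_(m, n)) : open U -> measurable U.
Proof. by move=> oU; exact: sub_sigma_algebra. Qed.

Lemma measurable_coord m n i j :
  measurable_fun setT (fun A : 'M[R]_(m, n) => A i j).
Proof.
apply: (measurability _ (RGenOpens.measurableE R)) => _ [_ [a [b -> <-]]].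
rewrite setTI; apply: borel_open; apply: open_comp => [A _|].
  exact: coord_continuous.
exact: interval_open.
Qed.

Lemma measurable_coordP d (T : measurableType d) m n (f : T -> 'M[R]_(m, n)) :
  (forall i j, measurable_fun setT (fun t => f t i j)) ->
  measurable_fun setT f.
Proof.
move=> mf; apply: (@measurability _ _ _ _ _ _ (@open 'M[R]_(m, n))) => //.
move=> _ [U oU <-]; rewrite setTI.
pose B (q : 'M[rat]_(m, n) * nat) : set 'M[R]_(m, n) :=
  ball (map_mx ratr q.1 : 'M[R]_(m, n)) q.2.+1%:R^-1.
have -> : U = \bigcup_(q in [set q | B q `<=` U]) B q.
  apply/seteqP; split => [A UA|A [q /= qU]]; last exact: qU.
  have : nbhs A U by exact: open_nbhs_nbhs.
  move=> /nbhs_ballP [e /= e0 eU].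
  have [N Ne] : exists N : nat, N.+1%:R^-1 < e / 2.
    have e20 : 0 < e / 2 by rewrite divr_gt0.
    exists (Num.trunc (e / 2)^-1).
    by rewrite invf_plt ?posrE// truncnS_gt.
  have /choice[q qA] : forall ij : 'I_m * 'I_n, exists q : rat,
      ratr q \in `](A ij.1 ij.2 - N.+1%:R^-1), (A ij.1 ij.2 + N.+1%:R^-1)[.
    by move=> ij; apply: rat_in_itvoo; rewrite ltrBlDr -addrA ltrDl addr_gt0.
  pose c : 'M[R]_(m, n) := map_mx ratr (\matrix_(i, j) q (i, j)).
  have BA : ball c N.+1%:R^-1 (A : 'M[R]_(m, n)).
    split=> [|i j]; first by rewrite invr_gt0.
    rewrite /ball/= !mxE.
    by have := qA (i, j); rewrite in_itv/= -ltr_distlC distrC.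
  exists (\matrix_(i, j) q (i, j), N) => //= C BC; apply: eU.
  apply: (@le_ball _ _ _ (N.+1%:R^-1 + N.+1%:R^-1)).
    by rewrite ltW// (splitr e) ltrD.
  exact: ball_triangle (ball_sym BA) BC.
rewrite preimage_bigcup; rewrite bigcup_mkcond.
apply: countable_bigcupT_measurable => // q; case: ifPn => // _.
rewrite [X in measurable X](_ : _ =
    \bigcap_(i in [set: 'I_m]) \bigcap_(j in [set: 'I_n])
    (setT `&` (fun t => f t i j) @^-1` `](ratr (q.1 i j) - q.2.+1%:R^-1),
                    (ratr (q.1 i j) + q.2.+1%:R^-1)[%classic)).
  apply: fin_bigcap_measurable; first exact: finite_finset.
  move=> i _; apply: fin_bigcap_measurable; first exact: finite_finset.
  by move=> j _; apply: mf => //; exact: measurable_itv.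
apply/seteqP; split => [t [_ /= Bt] i _ j _|t Bt] /=.
  by split=> //; have := Bt i j; rewrite in_itv/= /ball/= mxE -ltr_distlC.
split=> [|i j]; first by rewrite invr_gt0.
have [_] := Bt i I j I; rewrite /ball/= mxE.
by rewrite in_itv/= -ltr_distlC.
Qed.

Definition rcons0 n (p : measurableTypeR R * 'rV[R]_n) : 'rV[R]_n.+1 :=
  \row_i oapp (p.2 ord0) p.1 (unlift ord0 i).

Lemma measurable_rcons0 n : measurable_fun setT (@rcons0 n).
Proof.
apply: measurable_coordP => i j.
under eq_fun do rewrite mxE.
case: unliftP => [k _|_] /=; last exact: measurable_fst.
exact: measurableT_comp (@measurable_coord _ _ _ _) measurable_snd.
Qed.

Definition rsplit0 n (v : 'rV[R]_n.+1) : measurableTypeR R * 'rV[R]_n :=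
  (v ord0 ord0, \row_i v ord0 (lift ord0 i)).

Lemma measurable_rsplit0 n : measurable_fun setT (@rsplit0 n).
Proof.
apply: measurable_fun_pair; first exact: measurable_coord.
apply: measurable_coordP => i j.
by under eq_fun do rewrite mxE; exact: measurable_coord.
Qed.

Lemma rcons0K n : cancel (@rcons0 n) (@rsplit0 n).
Proof.
case=> x v; congr pair; first by rewrite mxE unlift_none.
by apply/rowP => i; rewrite !mxE liftK.
Qed.

Lemma sigma_finite_prod d1 d2 (T1 : measurableType d1) (T2 : measurableType d2)
    (m1 : {sigma_finite_measure set T1 -> \bar R})
    (m2 : {sigma_finite_measure set T2 -> \bar R}) :
  sigma_finite setT (m1 \x m2)%E.
Proof.
have /sigma_finiteP[F [TF ndF Foo]] := sigma_finiteT m1.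
have /sigma_finiteP[G [TG ndG Goo]] := sigma_finiteT m2.
exists (fun n => F n `*` G n).
  rewrite -setXTT TF TG predeqE => -[x y]; split.
    move=> [/= [n _ Fnx] [k _ Gky]]; exists (maxn n k) => //; split.
    - by move: x Fnx; exact/subsetPset/ndF/leq_maxl.
    - by move: y Gky; exact/subsetPset/ndG/leq_maxr.
  by move=> [n _ []/= ? ?]; split; exists n.
move=> k; have [? ?] := Foo k; have [? ?] := Goo k.
split; first exact: measurableX.
by rewrite product_measure1E// lte_mul_pinfty// ge0_fin_numE.
Qed.

Section step.
Variables (n : nat) (mu : {sigma_finite_measure set 'rV[R]_n -> \bar R}).

Definition lebesgue_step : set 'rV[R]_n.+1 -> \bar R :=
  pushforward (lebesgue_measure \x mu)%E (@rcons0 n).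

HB.instance Definition _ := Measure.copy lebesgue_step
  (measure_function_pushforward__canonical__measure_function_Measure
    (lebesgue_measure \x mu)%E (@measurable_rcons0 n)).

Lemma lebesgue_step_sigma_finite : sigma_finite setT lebesgue_step.
Proof.
have [F UF Ffin] := sigma_finite_prod lebesgue_measure mu.
exists (fun k => @rsplit0 n @^-1` F k).
  by rewrite -preimage_bigcup -UF preimage_setT.
move=> k; have [mF finF] := Ffin k; split.
  by rewrite -[X in measurable X]setTI; exact: measurable_rsplit0.
rewrite /lebesgue_step /pushforward -comp_preimage (_ : _ \o _ = id) //.
by apply/funext => p /=; rewrite rcons0K.
Qed.

HB.instance Definition _ := Measure_isSigmaFinite.Build _ _ _ lebesgue_step
  lebesgue_step_sigma_finite.
End step.

Fixpoint lebesgue_rV n : {sigma_finite_measure set 'rV[R]_n -> \bar R} :=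
  match n with
  | 0 => @dirac _ 'rV[R]_0 0 R
  | n'.+1 => lebesgue_step (lebesgue_rV n')
  end.

End lebesgue_rV.

Section lebesgue_torus.
Context (R : realType).

Lemma measurable_box n (A : 'I_n -> set R) : (forall i, measurable (A i)) ->
  measurable [set v : 'rV[R]_n | forall i, A i (v ord0 i)].
Proof.
move=> mA; rewrite [X in measurable X](_ : _ = \bigcap_(i in [set: 'I_n])
    (setT `&` (fun v : 'rV[R]_n => v ord0 i) @^-1` A i)).
  apply: fin_bigcap_measurable; first exact: finite_finset.
  by move=> i _; exact: (@measurable_coord R 1 n ord0 i measurableT).
by apply/seteqP; split => [v vA i _|v vA i]; [split|case: (vA i I)].
Qed.

Lemma lebesgue_rV_box n (A : 'I_n -> set R) : (forall i, measurable (A i)) ->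
  lebesgue_rV R n [set v | forall i, A i (v ord0 i)] =
  (\prod_(i < n) lebesgue_measure (A i))%E.
Proof.
elim: n A => [|n IHn] A mA /=.
  rewrite big_ord0 diracE mem_set// => -[]//.
rewrite big_ord_recl -IHn; last by move=> i.
transitivity ((lebesgue_measure \x lebesgue_rV R n)%E
    (A ord0 `*` [set v : 'rV[R]_n | forall i, A (lift ord0 i) (v ord0 i)])); last first.
  apply: product_measure1E; first exact: mA.
  by apply: (@measurable_box _ (fun i => A (lift ord0 i))) => i; exact: mA.
rewrite /lebesgue_step /pushforward; congr (_ _).
apply/seteqP; split => -[x v] /=.
  move=> H; split=> /= [|i]; first by have := H ord0; rewrite mxE unlift_none.
  by have := H (lift ord0 i); rewrite mxE liftK.
move=> [/= x0 vA] i; rewrite mxE; case: unliftP => [j ->|->] //=.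
Qed.

Context (d : nat).

Definition unit_cube : set 'rV[R]_d :=
  [set x | forall i, `[0, 1[%classic (x ord0 i)].

Lemma measurable_unit_cube : measurable unit_cube.
Proof. by apply: (@measurable_box _ (fun=> _)) => i; exact: measurable_itv. Qed.

Lemma measurable_torus_proj : measurable_fun setT (@torus_proj R d).
Proof.
apply: (@measurability _ _ _ _ _ _ (@open (torus R d))) => //.
by move=> _ [U oU <-]; rewrite setTI; exact: borel_open.
Qed.

Definition lebesgue_torus : set (torus R d) -> \bar R :=
  pushforward (mrestr (lebesgue_rV R d) measurable_unit_cube) (@torus_proj R d).

HB.instance Definition _ := Measure.copy lebesgue_torus
  (measure_function_pushforward__canonical__measure_function_Measure
    (mrestr (lebesgue_rV R d) measurable_unit_cube) measurable_torus_proj).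

Lemma lebesgue_torus_setT : lebesgue_torus setT = 1%E.
Proof.
rewrite /lebesgue_torus /pushforward preimage_setT /mrestr setTI.
rewrite (@lebesgue_rV_box _ (fun=> `[0, 1[%classic)) => [|i];
  last exact: measurable_itv.
rewrite big1// => i _.
by rewrite lebesgue_measure_itv/= lte_fin ltr01 oppr0 adde0.
Qed.

HB.instance Definition _ := Measure_isProbability.Build _ _ _ lebesgue_torus
  lebesgue_torus_setT.
End lebesgue_torus.

Section euclidean.
Context (R : realType) (n : nat).
Implicit Types u v : 'rV[R]_n.

Definition dotp u v : R := \sum_i u ord0 i * v ord0 i.
Definition enorm u : R := Num.sqrt (dotp u u).
Definition eball u (r : R) : set 'rV[R]_n := [set v | enorm (v - u) < r].
End euclidean.

Section measures.
Context (R : realType) (dT : measure_display) (T : measurableType dT).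

(* Measurability of [f] on [D] for the completion of [mu]: equality with a
   Borel function off a [mu]-null set. *)
Definition ae_measurable (mu : set T -> \bar R) (D : set T) (f : T -> R) :=
  exists2 g : T -> R, measurable_fun D g &
    mu.-negligible [set t | D t /\ f t <> g t].

Definition weakstar_measurable (mu : set T -> \bar R) (D : set T)
    dY (Y : measurableType dY) (C : set (Y -> R))
    (kappa : T -> probability Y R) :=
  forall g, C g -> ae_measurable mu D (fun t => \int[kappa t]_y g y).

Definition singular (mu ref : set T -> \bar R) :=
  exists N, [/\ measurable N, ref N = 0%E & mu (~` N) = 0%E].

(* [mu = f ref + s] is the Lebesgue decomposition of [mu] with respect to
   [ref]; [f] ranges over all the everywhere nonnegative finite versions. *)
Definition lebesgue_decomposition (ref mu : set T -> \bar R) (f : T -> R)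
    (s : set T -> \bar R) :=
  [/\ measurable_fun setT f, forall t, 0 <= f t, singular s ref &
      forall B, measurable B -> mu B = (\int[ref]_(t in B) (f t)%:E + s B)%E].

(* [f] is a version of the Radon-Nikodym density [d beta / d ref], i.e. the
   density of the part of [beta] that is absolutely continuous with respect to
   [ref]; the remaining part of [beta] lives on a [ref]-null set [N]. *)
Definition rn_density (ref : {measure set T -> \bar R}) (beta : set T -> R) (f : T -> R) :=
  ref.-integrable setT (EFin \o f) /\
  exists N, [/\ measurable N, ref N = 0%E & forall V, measurable V ->
    beta V = \int[ref]_(t in V) f t + beta (V `&` N)].

Definition rn_density_rV n (ref : {measure set T -> \bar R})
    (beta : set T -> 'rV[R]_n) (f : T -> 'rV[R]_n) :=
  forall i, rn_density ref (fun V => beta V ord0 i) (fun t => f t ord0 i).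
End measures.

Definition C0 (R : realType) (Y : topologicalType) : set (Y -> R) :=
  [set g | continuous g /\ forall e, 0 < e ->
     exists2 K, compact K & forall y, ~ K y -> `|g y| < e].
Arguments C0 R Y : clear implicits.

Section integrands.
Context (R : realType) (d m : nat).
Local Notation Rd := 'rV[R]_d.
Local Notation Z := (torus R d).
Local Notation E := 'rV[R]_m.
Variable Omega : set Rd.
Implicit Types f : Rd -> Z -> E -> R.

Definition continuous_integrand f :=
  {within Omega `*` setT `*` setT,
    continuous (fun q : Rd * Z * E => f q.1.1 q.1.2 q.2)}.

Definition recession_filter (x : Rd) (xi : Z) : set_system (Rd * Z * R) :=
  filter_prod (filter_prod (within Omega (nbhs x)) (nbhs xi)) (pinfty_nbhs R).

Definition recession_quotient f (z : E) (q : Rd * Z * R) : R :=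
  f q.1.1 q.1.2 (q.2 *: z) / q.2.

Definition recession f (x : Rd) (xi : Z) (z : E) : R :=
  lim (recession_quotient f z @ recession_filter x xi).

Definition upper_recession f x xi z : \bar R :=
  limf_esup (EFin \o recession_quotient f z) (recession_filter x xi).

Definition lower_recession f x xi z : \bar R :=
  limf_einf (EFin \o recession_quotient f z) (recession_filter x xi).

Definition R2 f := continuous_integrand f /\
  forall x xi z, closure Omega x ->
    upper_recession f x xi z = (recession f x xi z)%:E /\
    lower_recession f x xi z = (recession f x xi z)%:E.

Definition open_ballE : set E := [set z | enorm z < 1].

Definition E2 f := continuous_integrand f /\
  exists Tf : Rd * Z * E -> R,
    {within closure (Omega `*` setT `*` open_ballE), continuous Tf} /\
    forall x xi z, Omega x -> open_ballE z ->
      Tf (x, xi, z) = (1 - enorm z) * f x xi ((1 - enorm z)^-1 *: z).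
End integrands.

Section young_measures.
Context (R : realType) (d m : nat).
Local Notation Rd := 'rV[R]_d.
Local Notation Z := (torus R d).
Local Notation E := 'rV[R]_m.
Local Notation leb := (lebesgue_rV R d).
Local Notation lebZ := (@lebesgue_torus R d).

(* The four-tuple (nu, lambda, rho, nu^oo) is [(osc, conc, conc_scale,
   conc_angle)]. Maps (resp. measures) on the closure of Omega are extended
   arbitrarily (resp. by zero) to the whole space; measures on the unit sphere
   of [E] are measures on [E] that are concentrated on the sphere. *)
Record young_tuple := YoungTuple {
  osc : Rd -> Z -> probability E R ;
  conc : {finite_measure set Rd -> \bar R} ;
  conc_scale : Rd -> probability Z R ;
  conc_angle : Rd -> Z -> probability E R }.

Implicit Types nu : young_tuple.

(* the measure [lambda (x) rho_x] *)
Definition disintegrated (lambda : {finite_measure set Rd -> \bar R})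
    (rho : Rd -> probability Z R) : set (Rd * Z) -> \bar R :=
  fun A => (\int[lambda]_x rho x (xsection A x))%E.

(* By Tietze's theorem the restrictions to the unit sphere of the functions in
   [C0] are all the continuous functions on the sphere. *)
Record Y2 (Omega : set Rd) nu : Prop := {
  osc_measurable : weakstar_measurable (leb \x lebZ)%E
    (closure Omega `*` setT) (C0 R E) (fun p => osc nu p.1 p.2) ;
  osc_moment : (\int[leb \x lebZ]_(p in closure Omega `*` setT)
    \int[osc nu p.1 p.2]_z (enorm z)%:E < +oo)%E ;
  conc_supp : conc nu (~` closure Omega) = 0%E ;
  conc_scale_measurable :
    weakstar_measurable (conc nu) (closure Omega) (C0 R Z) (conc_scale nu) ;
  conc_angle_measurable :
    weakstar_measurable (disintegrated (conc nu) (conc_scale nu))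
      (closure Omega `*` setT) (C0 R E) (fun p => conc_angle nu p.1 p.2) ;
  conc_angle_sphere : forall x xi, closure Omega x ->
    conc_angle nu x xi [set z | enorm z = 1] = 1%E }.

(* [mu = a leb + th s] is the Radon-Nikodym-Lebesgue decomposition of the
   vector measure [mu] on Omega, where [s] is the total variation of the
   singular part of [mu] and [th] its polar density. *)
Record rnl_decomposition (Omega : set Rd)
    (mu : 'I_m -> {charge set Rd -> \bar R}) (a : Rd -> E)
    (s : {finite_measure set Rd -> \bar R}) (th : Rd -> E) : Prop := {
  rnl_ac : forall i, leb.-integrable Omega (fun x => (a x ord0 i)%:E) ;
  rnl_supp : s (~` Omega) = 0%E ;
  rnl_singular : singular s leb ;
  rnl_polar_measurable : measurable_fun Omega th ;
  rnl_polar : {ae s, forall x, enorm (th x) = 1} ;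
  rnl_eq : forall i B, measurable B ->
    mu i B = (\int[leb]_(x in B `&` Omega) (a x ord0 i)%:E +
              \int[s]_(x in B `&` Omega) (th x ord0 i)%:E)%E }.

Definition generates (Omega : set Rd) (eps : nat -> R) (a : nat -> Rd -> E)
    (s : nat -> {finite_measure set Rd -> \bar R}) (th : nat -> Rd -> E) nu :=
  forall f, E2 Omega f ->
    \int[leb]_(x in Omega) f x (torus_proj ((eps j)^-1 *: x)) (a j x) +
    \int[s j]_(x in Omega)
      recession Omega f x (torus_proj ((eps j)^-1 *: x)) (th j x)
    @[j --> \oo] -->
    \int[leb]_(x in Omega) (\int[lebZ]_xi (\int[osc nu x xi]_z f x xi z)) +
    \int[conc nu]_(x in closure Omega) (\int[conc_scale nu x]_xi
      (\int[conc_angle nu x xi]_z recession Omega f x xi z)).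

Section operator.
Context (l k : nat).
Local Notation F := 'rV[R]_l.
Implicit Types phi : Rd -> F.

Definition partials (s : seq 'I_d) phi : Rd -> F :=
  foldr (fun i g x => 'D_(delta_mx ord0 i) g x) phi s.

(* multi-indices with entries at most [k], which include all those of length at
   most [k] *)
Definition multiindex := {ffun 'I_d -> 'I_k.+1}.
Definition mlength (al : multiindex) : nat := (\sum_i al i)%N.
Definition mpartial (al : multiindex) phi : Rd -> F :=
  partials (flatten [seq nseq (al i) i | i <- enum 'I_d]) phi.

Definition test_function (Omega : set Rd) phi :=
  (forall s x, differentiable (partials s phi) x) /\
  exists K, [/\ compact K, K `<=` Omega & forall x, ~ K x -> phi x = 0].

Definition sobolev_norm (Omega : set Rd) (q : R) phi : R :=
  (\sum_(al | (mlength al <= k)%N)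
    \int[leb]_(x in Omega) (enorm (mpartial al phi x) `^ q)) `^ q^-1.

(* the norm of W^{-k,p}(Omega; F), the dual of W_0^{k,p'}(Omega; F) *)
Definition neg_sobolev_norm (Omega : set Rd) (p : R) (T : (Rd -> F) -> R) :
    \bar R :=
  ereal_sup [set `|T phi|%:E | phi in [set phi | test_function Omega phi /\
    sobolev_norm Omega (p / (p - 1)) phi <= 1]].

(* [A al] is the matrix of A_al in Lin(E; F) acting on row vectors on the
   right; only the entries with [mlength al = k] matter. The distribution
   [A mu], for [mu = a leb + th s], is
   phi |-> (-1)^k \sum_(|al| = k) \int <A_al dmu, D^al phi>. *)
Definition operator_distribution (Omega : set Rd)
    (A : multiindex -> 'M[R]_(m, l)) (a : Rd -> E)
    (s : {finite_measure set Rd -> \bar R}) (th : Rd -> E) phi : R :=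
  (-1) ^+ k * \sum_(al | mlength al == k)
    (\int[leb]_(x in Omega) dotp (a x *m A al) (mpartial al phi x) +
     \int[s]_(x in Omega) dotp (th x *m A al) (mpartial al phi x)).

Definition A_free (Omega : set Rd) (A : multiindex -> 'M[R]_(m, l)) (p : R)
    nu :=
  exists (eps : nat -> R) (mu : nat -> 'I_m -> {charge set Rd -> \bar R})
    (a : nat -> Rd -> E) (s : nat -> {finite_measure set Rd -> \bar R})
    (th : nat -> Rd -> E),
  [/\ (forall j, 0 < eps j) /\ decreasing_seq eps, eps j @[j --> \oo] --> 0,
      forall j, rnl_decomposition Omega (mu j) (a j) (s j) (th j),
      generates Omega eps a s th nu &
      neg_sobolev_norm Omega p (operator_distribution Omega A (a j) (s j) (th j))
        @[j --> \oo] --> 0%E].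
End operator.

(* d leb / d ls vanishes at [x], where [ls] is the singular part of the
   concentration measure; recall that [0^-1 = +oo] in [\bar R]. *)
Definition singular_point (Omega : set Rd) (ls : set Rd -> \bar R) (x : Rd) :=
  closure Omega x /\
  (leb (eball x r) / ls (eball x r))%E @[r --> 0^'+] --> 0%E.

Definition regular_point (Omega : set Rd) (ls : set Rd -> \bar R) (x : Rd) :=
  closure Omega x /\ ~ singular_point Omega ls x.

(* The slice of [nu] at [x] satisfies the measurability and integrability that
   [Y2] demands of [nu] itself, which is what is needed for the second-scale
   barycenters at [x] to be measures. By Fubini's theorem this holds at almost
   every point, but [osc] and [conc_angle] are arbitrary on null sets. *)
Definition barycenter_defined nu (lac : Rd -> R) (x : Rd) :=
  [/\ weakstar_measurable lebZ setT (C0 R E) (osc nu x),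
      (\int[lebZ]_xi \int[osc nu x xi]_z (enorm z)%:E < +oo)%E &
      0 < lac x ->
        weakstar_measurable (conc_scale nu x) setT (C0 R E) (conc_angle nu x)].

Definition barycenter nu (lac : Rd -> R) (x : Rd) (V : set Z) : E :=
  \row_i (\int[lebZ]_(xi in V) (\int[osc nu x xi]_z z ord0 i) +
    lac x * \int[conc_scale nu x]_(xi in V)
      (\int[conc_angle nu x xi]_z z ord0 i)).

Definition barycenter_of (Omega : set Rd) (g : Rd -> Z -> E -> R) nu
    (lac : Rd -> R) (x : Rd) (V : set Z) : R :=
  \int[lebZ]_(xi in V) (\int[osc nu x xi]_z g x xi z) +
  lac x * \int[conc_scale nu x]_(xi in V)
    (\int[conc_angle nu x xi]_z recession Omega g x xi z).
End young_measures.

(* Main.v *)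
(* Both inequalities are Jensen's inequality for the slice of the Young measure
   at [x]. Convexity and the strong recession property make [h] uniformly
   Lipschitz in [z] and make [h xi z] depend on [xi] continuously up to an
   error [delta * (1 + |z|)], uniformly in [z]. Hence, near any [(xi0, z0)],
   an affine minorant [a.z + beta] of [h xi0] that is almost exact at [z0]
   satisfies
     [a.z + beta - delta * (1 + |z|) <= h xi z]  and
     [h xi z' <= a.z' + beta + eta]
   for [xi] near [xi0], all [z], and [z'] near [z0]. Integrating the first
   inequality bounds the barycenter of [h] on small sets from below, up to
   [delta] times a fixed finite measure [M]. If the density inequality failed by
   [2 * eta] on a set [W] where the density is bounded, then a finite cover of
   torus x ball would give [eta * |W| <= delta * M(W)] for every [delta], so
   [W] is null. For the singular part one works on a Lebesgue null set carrying
   it, where homogeneity of the recession function allows [beta = 0]. *)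
Require Import Defs.
From HB Require Import structures.
From mathcomp Require Import all_boot all_order all_algebra.
From mathcomp Require Import all_classical all_reals all_analysis.
From mathcomp Require Import generic_quotient measurable_realfun lra.
Set Implicit Arguments.
Unset Strict Implicit.
Unset Printing Implicit Defensive.
Import Order.TTheory GRing.Theory Num.Theory.
Import numFieldNormedType.Exports.
Local Open Scope classical_set_scope.
Local Open Scope ring_scope.

(** * Integration up to null sets *)

Section null_sets.
Context (dT : measure_display) (T : measurableType dT) (R : realType).
Variable mu : {measure set T -> \bar R}.
Import HBNNSimple.

(* Neither function is assumed measurable: the integral is a supremum over
   simple minorants, and these can be set to zero on [N]. *)
Lemma ge0_le_integral_off_null (N : set T) (f g : T -> \bar R) :
  measurable N -> mu N = 0%E ->
  (forall t, (0 <= f t)%E) -> (forall t, (0 <= g t)%E) ->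
  (forall t, ~ N t -> (f t <= g t)%E) ->
  (\int[mu]_t f t <= \int[mu]_t g t)%E.
Proof.
move=> mN N0 f0 g0 fg; rewrite !ge0_integralTE//.
apply: ge_ereal_sup => _ [k /= kf <-].
have [k' k'E] : exists k' : {nnsfun T >-> R}, forall t, k' t = k t * \1_(~` N) t.
  by exists (proj_nnsfun k (measurableC mN)).
apply: le_trans (_ : (sintegral mu k' <= _)%E); last first.
  apply: ereal_sup_ubound; exists k' => //= t; rewrite k'E indicE.
  case: (boolP (t \in ~` N)) => [tN|tN]; last by rewrite mulr0 g0.
  by rewrite mulr1; apply: le_trans (kf t) (fg _ _); move: tN; rewrite inE.
rewrite -!integralT_nnsfun le_eqVlt; apply/orP; left; apply/eqP.
apply: ge0_ae_eq_integral => //=.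
- exact/measurable_EFinP.
- exact/measurable_EFinP.
- by move=> t _; rewrite lee_fin.
- by move=> t _; rewrite lee_fin.
exists N; split => // t /=; apply: contra_notP => Nt _.
by rewrite k'E indicE mem_set// mulr1.
Qed.

Lemma eq_integral_off_null (N V : set T) (f g : T -> \bar R) :
  measurable N -> mu N = 0%E -> (forall t, V t -> ~ N t -> f t = g t) ->
  (\int[mu]_(t in V) f t = \int[mu]_(t in V) g t)%E.
Proof.
move=> mN N0 fg; rewrite integral_mkcond [RHS]integral_mkcond.
have {fg} : forall t, ~ N t -> (f \_ V) t = (g \_ V) t.
  by move=> t Nt; rewrite !patchE; case: ifPn => //; rewrite inE => /fg ->.
move: (f \_ V) (g \_ V) => {V}f {}g fg.
have H (k k' : T -> \bar R) : (forall t, (0 <= k t)%E) ->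
    (forall t, (0 <= k' t)%E) -> (forall t, ~ N t -> k t = k' t) ->
    (\int[mu]_t k t = \int[mu]_t k' t)%E.
  move=> k0 k'0 kk'; apply/eqP; rewrite eq_le.
  by apply/andP; split; apply: (ge0_le_integral_off_null mN) => // t /kk' ->.
rewrite integralE [RHS]integralE; congr (_ - _)%E; apply: H => //.
- by move=> t Nt; rewrite !funeposE fg.
- by move=> t Nt; rewrite !funenegE fg.
Qed.

Lemma Rintegral_null (V : set T) (f : T -> R) :
  measurable V -> mu V = 0%E -> \int[mu]_(t in V) f t = 0.
Proof.
move=> mV V0; rewrite /Rintegral (@eq_integral_off_null V V _ (cst 0%E))//.
by rewrite integral0.
Qed.

(** Slice integrals are only known to agree almost everywhere with Borel functions, so integrability
    is asked of such a representative. *)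
Definition ae_integrable (f : T -> R) :=
  exists2 g : T -> R, mu.-integrable setT (EFin \o g) &
    mu.-negligible [set t | f t <> g t].

Lemma eq_Rintegral_ae (f g : T -> R) (V : set T) :
  mu.-negligible [set t | f t <> g t] ->
  \int[mu]_(t in V) f t = \int[mu]_(t in V) g t.
Proof.
move=> [N [mN N0 sN]]; congr fine; apply: (eq_integral_off_null mN N0) => t _ Nt.
by congr EFin; apply: contra_notP Nt => fg; exact: sN.
Qed.

(** Borel representatives of the [f_ n], set to zero on one null set collecting all exceptional
    points, converge everywhere. *)
Lemma ae_measurable_cvg (f_ : nat -> T -> R) (f : T -> R) :
  (forall n, ae_measurable mu setT (f_ n)) ->
  {ae mu, forall t, f_ n t @[n --> \oo] --> f t} ->
  ae_measurable mu setT f.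
Proof.
move=> mf cf; have [g mg eg] : exists2 g : nat -> T -> R,
    forall n, measurable_fun setT (g n) &
    forall n, mu.-negligible [set t | f_ n t <> g n t].
  have /choice[g gP] : forall n, exists g : T -> R, measurable_fun setT g /\
      mu.-negligible [set t | f_ n t <> g t].
    move=> n; have [g mg [N [mN N0 sN]]] := mf n; exists g; split => //.
    by exists N; split => // t ft; apply: sN.
  by exists g => n; have [] := gP n.
have [N [mN N0 sN]] := negligibleU cf (negligible_bigcup eg).
exists (fun t => f t * \1_(~` N) t); last first.
  exists N; split => // t [_] /=; apply: contra_notP => Nt.
  by rewrite indicE mem_set// mulr1.
apply: (@measurable_fun_cvg _ _ _ _ (fun n t => g n t * \1_(~` N) t)).
  by move=> n; apply: measurable_funM => //; exact/measurable_indic/measurableC.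
move=> t _; rewrite indicE; case: (pselect (N t)) => Nt.
  rewrite memNset ?mulr0; last by move=> /(_ Nt).
  by under eq_fun do rewrite mulr0; exact: cvg_cst.
apply: cvgM; last exact: cvg_cst.
have ct : f_ n t @[n --> \oo] --> f t.
  by apply: contra_notP Nt => ct; apply: sN; left.
have et n : f_ n t = g n t.
  by apply: contra_notP Nt => et; apply: sN; right; exists n.
by move: ct; under eq_fun do rewrite et.
Qed.

Lemma ae_measurable_integrable (f g : T -> R) : ae_measurable mu setT f ->
  ae_integrable g -> {ae mu, forall t, `|f t| <= g t} -> ae_integrable f.
Proof.
move=> [f' mf' [N1 [mN1 N10 sN1]]] [g' ig' [N2 [mN2 N20 sN2]]] [N3 [mN3 N30 sN3]].
exists f'; last by exists N1; split => // t ft; apply: sN1.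
have mf'' : measurable_fun setT (EFin \o f') by exact/measurable_EFinP.
apply/integrableP; split=> //.
have /integrableP[_] := ig'; apply: le_lt_trans.
apply: ae_ge0_le_integral => //.
- by apply: measurableT_comp.
- by apply: measurableT_comp => //; exact: measurable_int ig'.
exists (N1 `|` N2 `|` N3); split.
- by do 2 apply: measurableU => //.
- by do 2 (rewrite null_set_setU//; try exact: measurableU).
move=> t /=; apply: contra_notP => Nt _; rewrite lee_fin.
have <- : f t = f' t by apply: contra_notP Nt => ?; left; left; apply: sN1.
have <- : g t = g' t by apply: contra_notP Nt => ?; left; right; apply: sN2.
apply: le_trans (ler_norm _).
by apply: contra_notP Nt => /negP fg; right; apply: sN3; apply/negP.
Qed.

Lemma le_Rintegral_ae (V : set T) (f g : T -> R) : measurable V ->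
  mu.-integrable setT (EFin \o f) -> mu.-integrable setT (EFin \o g) ->
  {ae mu, forall t, V t -> f t <= g t} ->
  \int[mu]_(t in V) f t <= \int[mu]_(t in V) g t.
Proof.
move=> mV fi gi [N [mN N0 sN]].
(* The minimum agrees with [f] on [V] off [N] and lies below [g] everywhere, which reduces the claim
   to a pointwise comparison. *)
have <- : \int[mu]_(t in V) Num.min (f t) (g t) = \int[mu]_(t in V) f t.
  congr fine; apply: (eq_integral_off_null mN N0) => t Vt Nt.
  congr EFin; apply/min_idPl; apply: contra_notP Nt => fg; apply: sN => /=.
  by move=> /(_ Vt).
have {}fi : mu.-integrable V (EFin \o f) by exact: integrableS fi.
have {}gi : mu.-integrable V (EFin \o g) by exact: integrableS gi.
apply: le_Rintegral => //; last by move=> t _; rewrite ge_min lexx orbT.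
have mf : measurable_fun V f by apply/measurable_EFinP; exact: measurable_int fi.
have mg : measurable_fun V g by apply/measurable_EFinP; exact: measurable_int gi.
apply: (@le_integrable _ _ _ _ _ _ _ (fun t => `|(f t)%:E| + `|(g t)%:E|)%E) => //.
- exact/measurable_EFinP/measurable_minr.
- move=> t Vt /=; rewrite lee_fin [leRHS]ger0_norm ?addr_ge0//.
  by rewrite /Num.min; case: ifP => _; rewrite ?lerDl ?lerDr.
- by apply: integrableD => //; exact: integrable_abse.
Qed.

End null_sets.

(** * Functions of linear growth on row vectors *)

Section row_vectors.
Context (R : realType) (m : nat).
Local Notation E := 'rV[R]_m.

Lemma continuous_measurable_rV (g : E -> R) : continuous g ->
  measurable_fun setT g.
Proof.
move=> cg; apply: (measurability _ (RGenOpens.measurableE R)) => _ [_ [a [b -> <-]]].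
rewrite setTI; apply: borel_open; apply: open_comp => [A _|]; first exact: cg.
exact: interval_open.
Qed.

Lemma continuous_emeasurable_rV (g : E -> R) : continuous g ->
  measurable_fun setT (fun z => (g z)%:E).
Proof. by move=> cg; apply/measurable_EFinP; exact: continuous_measurable_rV. Qed.

Lemma norm_coord_le (z : E) i : `|z ord0 i| <= `|z|.
Proof.
rewrite [leRHS]/Num.norm /= mx_normrE; apply/bigmax_geP; right => /=.
by exists (ord0, i).
Qed.

(** Estimates below use the maximum norm, whereas the moments of a Young measure are stated with the
    Euclidean norm; this comparison transfers finiteness. *)
Lemma norm_le_enorm (z : E) : `|z| <= enorm z.
Proof.
rewrite [leLHS]/Num.norm /= mx_normrE; apply/bigmax_leP; split.
  by rewrite /enorm sqrtr_ge0.
move=> [i j] _ /=; rewrite ord1 -sqrtr_sqr /enorm ler_wsqrtr//.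
rewrite /dotp (bigD1 j)//= expr2 lerDl sumr_ge0// => k _.
by rewrite -expr2 sqr_ge0.
Qed.

Lemma cvg_dotp (T : Type) (F : set_system T) (u v : T -> E) (a b : E) :
  Filter F -> u t @[t --> F] --> a -> v t @[t --> F] --> b ->
  dotp (u t) (v t) @[t --> F] --> dotp a b.
Proof.
move=> FF ua vb; apply: cvg_big => [|i _]; first exact: add_continuous.
by apply: cvgM; apply: (@continuous_cvg _ _ _ _ _ _ (fun M : E => M ord0 i)) => //;
  exact: coord_continuous.
Qed.

Lemma dotp_continuous (a : E) : continuous (dotp a).
Proof.
move=> z; apply: (@cvg_dotp _ (nbhs z) (fun=> a) id a z) => //.
exact: cvg_cst.
Qed.

Lemma measurable_enorm : measurable_fun setT (@enorm R m).
Proof.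
apply: (@measurableT_comp _ _ _ _ _ _ (@Num.sqrt R) _ (fun z : E => dotp z z)).
  apply: continuous_measurable_fun; exact: sqrt_continuous.
by apply: continuous_measurable_rV => z; exact: (@cvg_dotp _ (nbhs z) id id z z).
Qed.

Lemma compact_norm_le (r : R) : compact [set z : E | `|z| <= r].
Proof.
apply: bounded_closed_compact.
  by exists r; split; [exact: num_real|move=> x rx z /= /le_trans; apply; exact: ltW].
by apply: (@closed_comp _ _ (fun z : E => `|z|) [set x | x <= r]);
  [move=> z _; exact: norm_continuous|exact: closed_le].
Qed.

(** A continuous plateau, equal to one on the ball of radius [n] and zero outside radius [n.+1]. It
    turns continuous functions into elements of [C0], the test functions of weak-* measurability. *)
Definition cutoff (n : nat) (z : E) : R :=
  Num.max 0 (Num.min 1 (n.+1%:R - `|z|)).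

Lemma cutoff_ge0 n z : 0 <= cutoff n z.
Proof. by rewrite le_max lexx. Qed.

Lemma cutoff_le1 n z : cutoff n z <= 1.
Proof. by rewrite ge_max ler01 ge_min lexx. Qed.

Lemma cutoff_eq0 n z : n.+1%:R <= `|z| -> cutoff n z = 0.
Proof. by move=> nz; apply/max_idPl; rewrite ge_min subr_le0 nz orbT. Qed.

Lemma cutoff_eq1 n z : `|z| <= n%:R -> cutoff n z = 1.
Proof.
move=> nz; rewrite /cutoff (min_idPl _) ?(max_idPr _) ?ler01//.
by rewrite lerBrDr addrC -natr1 lerD2r.
Qed.

Lemma cutoff_continuous n : continuous (cutoff n).
Proof.
move=> z; apply: (@continuous_max R E (cst 0)
  (fun z => Num.min 1 (n.+1%:R - `|z|)) z); first exact: cst_continuous.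
apply: (@continuous_min R E (cst 1) (fun z => n.+1%:R - `|z|) z).
  exact: cst_continuous.
by apply: continuousB; [exact: cst_continuous|exact: norm_continuous].
Qed.

Lemma cutoff_nondecreasing n k z : (n <= k)%N -> cutoff n z <= cutoff k z.
Proof.
move=> nk; apply: le_max2 => //; apply: le_min2 => //.
by rewrite lerD2r ler_nat.
Qed.

Lemma cutoff_near1 z : \forall n \near \oo, cutoff n z = 1.
Proof.
near=> n; apply: cutoff_eq1; near: n; exact: nbhs_infty_ger.
Unshelve. all: by end_near. Qed.

Lemma C0_cutoff n (g : E -> R) : continuous g ->
  C0 R E (fun z => cutoff n z * g z).
Proof.
move=> cg; split=> [z|e e0].
  by apply: (@continuousM R E (cutoff n) g z); [exact: cutoff_continuous|exact: cg].
exists [set z | `|z| <= n.+1%:R]; first exact: compact_norm_le.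
by move=> z /= /negP; rewrite -ltNge => /ltW /cutoff_eq0 ->; rewrite mul0r normr0.
Qed.

Definition linear_growth (g : E -> R) :=
  continuous g /\ exists C, forall z, `|g z| <= C * (1 + `|z|).

Lemma integrable_linear_growth (P : probability E R) (g : E -> R) :
  linear_growth g -> (\int[P]_z `|z|%:E < +oo)%E ->
  P.-integrable setT (EFin \o g).
Proof.
move=> [cg [C gC]] Poo.
have iz : P.-integrable setT (fun z => C%:E * (1%:E + `|z|%:E))%E.
  apply: integrableZl => //; apply: integrableD => //.
    exact: finite_measure_integrable_cst.
  apply/integrableP; split.
    by apply: continuous_emeasurable_rV => z; exact: norm_continuous.
  by under eq_integral do rewrite /= normr_id.
apply: le_integrable iz => //.
- exact: continuous_emeasurable_rV.
- move=> z _ /=; rewrite lee_fin (le_trans (gC z))//; exact: ler_norm.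
Qed.

(** Dominated convergence with majorant [|g|]: the cutoffs lie between zero and one and are
    eventually one at each point. *)
Lemma cvg_Rintegral_cutoff (P : probability E R) (g : E -> R) :
  linear_growth g -> (\int[P]_z `|z|%:E < +oo)%E ->
  \int[P]_z (cutoff n z * g z) @[n --> \oo] --> \int[P]_z g z.
Proof.
move=> gl Poo; have ig := integrable_linear_growth gl Poo.
have [cg _] := gl.
have [] := @dominated_convergence _ _ _ P setT measurableT
  (fun n z => (cutoff n z * g z)%:E) (EFin \o g) (abse \o (EFin \o g)).
- by move=> n; apply: continuous_emeasurable_rV; exact: (C0_cutoff n cg).1.
- exact: continuous_emeasurable_rV.
- apply: aeW => z _ /=; apply: cvg_EFin; first by apply: nearW.
  apply: cvg_near_cst; near=> n => /=.
  by rewrite (_ : cutoff n z = 1) ?mul1r//; near: n; exact: cutoff_near1.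
- exact: integrable_abse.
- apply: aeW => z n _ /=; rewrite lee_fin normrM ger0_norm ?cutoff_ge0//.
  by rewrite ler_piMl// cutoff_le1.
move=> _ _ cv; apply: fine_cvg; move: cv; rewrite /= /Rintegral fineK//.
exact: integrable_fin_num ig.
Unshelve. all: by end_near. Qed.

End row_vectors.

(** * Integration against weak-* measurable kernels *)

Section affine.
Context (dT : measure_display) (T : measurableType dT) (R : realType).
Variables (mu : {measure set T -> \bar R}) (m : nat).
Hypothesis mu_finite : (mu setT < +oo)%E.

Lemma finite_integrable_cst (c : R) : mu.-integrable setT (EFin \o (fun=> c)).
Proof.
apply/integrableP; split; first exact/measurable_EFinP.
rewrite /= integral_cst//= lte_mul_pinfty// ?lee_fin//.
Qed.

(** An affine minorant is integrated first over [E] and then over the torus; this formula serves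
    both integrations. *)
Lemma Rintegral_affine (V : set T) (f : 'I_m -> T -> R) (w : T -> R)
    (a : 'rV[R]_m) (beta delta : R) : measurable V ->
  (forall i, mu.-integrable setT (EFin \o f i)) ->
  mu.-integrable setT (EFin \o w) ->
  mu.-integrable setT
    (fun t => (dotp a (\row_i f i t) + beta - delta * w t)%:E) /\
  \int[mu]_(t in V) (dotp a (\row_i f i t) + beta - delta * w t) =
  dotp a (\row_i \int[mu]_(t in V) f i t) + beta * fine (mu V) -
  delta * \int[mu]_(t in V) w t.
Proof.
move=> mV fi wi.
have iV g : mu.-integrable setT (EFin \o g) -> mu.-integrable V (EFin \o g).
  by apply: integrableS.
have iZ (c : R) g : mu.-integrable setT (EFin \o g) ->
    mu.-integrable setT (EFin \o (fun t => c * g t)).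
  by move=> ig; exact: (integrableZl _ c ig).
have iD g g' : mu.-integrable setT (EFin \o g) ->
    mu.-integrable setT (EFin \o g') ->
    mu.-integrable setT (EFin \o (fun t => g t + g' t)).
  by move=> ig ig'; exact: (integrableD _ ig ig').
have ic : mu.-integrable setT (EFin \o (fun=> beta)).
  exact: finite_integrable_cst.
have [si sE] : mu.-integrable setT (EFin \o (fun t => dotp a (\row_i f i t))) /\
    \int[mu]_(t in V) dotp a (\row_i f i t) =
    dotp a (\row_i \int[mu]_(t in V) f i t).
  rewrite /dotp; elim: (index_enum _) => [|i s [IHi IHE]].
    rewrite (_ : (fun t => _) = cst 0); last by apply/funext => t; rewrite big_nil.
    rewrite big_nil; split; first exact: finite_integrable_cst.
    by rewrite Rintegral_cst// mul0r.
  rewrite (_ : (fun t => _) = fun t => a ord0 i * f i t +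
      \sum_(j <- s) a ord0 j * (\row_k f k t) ord0 j); last first.
    by apply/funext => t; rewrite big_cons mxE.
  split; first by apply: iD => //; exact: iZ.
  rewrite RintegralD//; [|exact/iV/iZ|exact: iV].
  by rewrite RintegralZl//; [rewrite IHE big_cons mxE|exact: iV].
split.
  have := iD _ _ (iD _ _ si ic) (iZ (- delta) _ wi).
  by congr (integrable _ _ _); apply/funext => t /=; rewrite mulNr.
rewrite RintegralB//; [|exact/iV/iD|exact/iV/iZ].
rewrite RintegralD//; [|exact: iV|exact: iV].
by rewrite sE Rintegral_cst// RintegralZl//; exact: iV.
Qed.

End affine.

Section kernel.
Context (dT : measure_display) (T : measurableType dT) (R : realType) (m : nat).
Local Notation E := 'rV[R]_m.
Variables (mu : probability T R) (kappa : T -> probability E R).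
Hypothesis kappa_weakstar : weakstar_measurable mu setT (C0 R E) kappa.
Hypothesis kappa_moment : (\int[mu]_t \int[kappa t]_z (enorm z)%:E < +oo)%E.

Definition moment_finite (t : T) := (\int[kappa t]_z `|z|%:E < +oo)%E.

Lemma linear_growth_norm : linear_growth (fun z : E => `|z|).
Proof.
split; first by move=> z; exact: norm_continuous.
by exists 1 => z; rewrite normr_id mul1r lerDr.
Qed.

Lemma moment_le_enorm t :
  (\int[kappa t]_z `|z|%:E <= \int[kappa t]_z (enorm z)%:E)%E.
Proof.
apply: ge0_le_integral => //.
- by apply: continuous_emeasurable_rV => z; exact: norm_continuous.
- by apply/measurable_EFinP; exact: measurable_enorm.
- by move=> z _; rewrite lee_fin norm_le_enorm.
Qed.

(** Monotone convergence covers infinite limits too, as required to show afterwards that they occur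
    only on a null set. *)
Lemma cvg_moment_cutoff t : (\int[kappa t]_z (cutoff n z * `|z|))%:E
  @[n --> \oo] --> (\int[kappa t]_z `|z|%:E)%E.
Proof.
have cz := linear_growth_norm.1.
have mz n : measurable_fun setT (fun z : E => (cutoff n z * `|z|)%:E).
  by apply: continuous_emeasurable_rV; exact: (C0_cutoff n cz).1.
(* The truncated integrand is at most [n.+1], so its real and extended integrals agree. *)
have -> : (fun n => (\int[kappa t]_z (cutoff n z * `|z|))%:E) =
    (fun n => \int[kappa t]_z (cutoff n z * `|z|)%:E)%E.
  apply/funext => n; rewrite /Rintegral fineK//.
  apply: integrable_fin_num => //.
  apply: (@le_integrable _ _ _ _ _ measurableT _ (cst n.+1%:R%:E)) => //.
    move=> z _ /=; rewrite lee_fin ger0_norm ?mulr_ge0 ?cutoff_ge0//.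
    rewrite [leRHS]ger0_norm//; have [nz|/ltW nz] := leP (n.+1%:R) `|z|.
      by rewrite cutoff_eq0// mul0r.
    by rewrite (le_trans _ nz)// ler_piMl// cutoff_le1.
  exact: finite_measure_integrable_cst.
have -> : (\int[kappa t]_z `|z|%:E =
    \int[kappa t]_z limn (fun n => (cutoff n z * `|z|)%:E))%E.
  apply: eq_integral => z _; apply/esym/cvg_lim => //.
  apply: cvg_near_cst; near=> n.
  by rewrite (_ : cutoff n z = 1) ?mul1r//; near: n; exact: cutoff_near1.
apply: cvg_monotone_convergence => //.
- by move=> n z _; rewrite lee_fin mulr_ge0 ?cutoff_ge0.
- move=> z _ n k nk; rewrite lee_fin ler_wpM2r//; exact: cutoff_nondecreasing.
Unshelve. all: by end_near. Qed.

(** The truncated moments have Borel representatives, hence their limit is measurable off a null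
    set. It is integrable by [kappa_moment] and therefore finite almost everywhere. *)
Lemma moment_finite_ae : {ae mu, forall t, moment_finite t}.
Proof.
have cz := linear_growth_norm.1.
have /choice[G GP] : forall n, exists G : T -> R, measurable_fun setT G /\
    mu.-negligible [set t | \int[kappa t]_z (cutoff n z * `|z|) <> G t].
  move=> n; have [G mG [N [mN N0 sN]]] := kappa_weakstar (C0_cutoff n cz).
  by exists G; split => //; exists N; split => // t Gt; apply: sN.
have [N [mN N0 sN]] := negligible_bigcup (fun n => (GP n).2).
have eG t : ~ N t -> forall n, \int[kappa t]_z (cutoff n z * `|z|) = G n t.
  by move=> Nt n; apply: contra_notP Nt => Gt; apply: sN; exists n.
pose mom t := (\int[kappa t]_z `|z|%:E)%E.
have mom0 t : (0 <= mom t)%E by apply: integral_ge0 => z _; rewrite lee_fin.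
have mmom : measurable_fun setT (mom \_ (~` N)).
  apply: (@emeasurable_fun_cvg _ _ _ _ (fun n => (EFin \o G n) \_ (~` N))).
    move=> n; apply/(measurable_restrict _ _ _).1 => //; first exact: measurableC.
    apply: measurable_funTS; exact/measurable_EFinP/(GP n).1.
  move=> t _; rewrite /patch; case: ifPn; last by move=> _; exact: cvg_cst.
  rewrite inE => Nt /=; have := @cvg_moment_cutoff t.
  by under eq_fun do rewrite eG//.
have imom : mu.-integrable setT (mom \_ (~` N)).
  apply/integrableP; split => //; apply: le_lt_trans kappa_moment.
  apply: (ge0_le_integral_off_null mN N0) => // t.
    by apply: integral_ge0 => z _; rewrite lee_fin sqrtr_ge0.
  move=> Nt; rewrite patchE mem_set// gee0_abs//; exact: moment_le_enorm.
have [N' [mN' N'0 sN']] := integrable_ae measurableT imom.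
exists (N `|` N'); split; [exact: measurableU|by rewrite null_set_setU//|].
move=> t /=; apply: contra_notP => /not_orP[Nt N't].
have : (mom \_ (~` N)) t \is a fin_num.
  by apply: contra_notP N't => mt; apply: sN' => /= /(_ I).
by rewrite patchE mem_set// ge0_fin_numE.
Qed.

(** Truncation carries weak-* measurability from [C0] to functions of linear growth. *)
Lemma ae_measurable_Rintegral_kernel (g : E -> R) : linear_growth g ->
  ae_measurable mu setT (fun t => \int[kappa t]_z g z).
Proof.
move=> gl; apply: (@ae_measurable_cvg _ _ _ _
    (fun n t => \int[kappa t]_z (cutoff n z * g z))).
  by move=> n; apply: kappa_weakstar; exact: C0_cutoff gl.1.
apply: filterS moment_finite_ae => t; exact: cvg_Rintegral_cutoff.
Qed.

Lemma ae_integrable_moment : ae_integrable mu (fun t => \int[kappa t]_z `|z|).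
Proof.
have [G mG [N [mN N0 sN]]] := ae_measurable_Rintegral_kernel linear_growth_norm.
have [N' [mN' N'0 sN']] := moment_finite_ae.
exists G; last by exists N; split => // t Gt; apply: sN.
apply/integrableP; split; first exact/measurable_EFinP.
apply: le_lt_trans kappa_moment.
apply: (@ge0_le_integral_off_null _ _ _ _ (N `|` N')) => //.
- exact: measurableU.
- by rewrite null_set_setU.
- by move=> t; apply: integral_ge0 => z _; rewrite lee_fin sqrtr_ge0.
move=> t /not_orP[Nt N't] /=.
have <- : \int[kappa t]_z `|z| = G t by apply: contra_notP Nt => ?; apply: sN.
have ft : moment_finite t by apply: contra_notP N't => ?; apply: sN'.
rewrite ger0_norm; last by apply: Rintegral_ge0.
apply: le_trans (moment_le_enorm t); rewrite /Rintegral fineK//.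
by rewrite ge0_fin_numE//; apply: integral_ge0 => z _; rewrite lee_fin.
Qed.

Lemma Rintegral_norm1 t : moment_finite t ->
  \int[kappa t]_z (1 + `|z|) = 1 + \int[kappa t]_z `|z|.
Proof.
move=> ft; rewrite RintegralD//.
- rewrite Rintegral_cst// mul1r -[1 in RHS]/(fine 1%E).
  by congr (fine _ + _); exact: (@probability_setT _ _ _ (kappa t)).
- exact: finite_measure_integrable_cst.
- exact: integrable_linear_growth linear_growth_norm ft.
Qed.

Lemma linear_growth_norm1 : linear_growth (fun z : E => 1 + `|z|).
Proof.
split.
  move=> z; apply: (@continuousD _ R^o E (cst 1) (fun z : E => `|z|) z).
    exact: cst_continuous.
  exact: norm_continuous.
by exists 1 => z; rewrite ger0_norm ?mul1r// addr_ge0.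
Qed.

Lemma norm_Rintegral_kernel (t : T) (g : E -> R) C : moment_finite t ->
  continuous g -> (forall z, `|g z| <= C * (1 + `|z|)) ->
  `|\int[kappa t]_z g z| <= C * (1 + \int[kappa t]_z `|z|).
Proof.
move=> ft cg gC; have gl : linear_growth g by split => //; exists C.
have ig := integrable_linear_growth gl ft.
have i1 := integrable_linear_growth linear_growth_norm1 ft.
apply: le_trans (le_normr_Rintegral _ ig) _ => //.
rewrite -Rintegral_norm1// -RintegralZl//.
apply: le_Rintegral => //.
- exact: (integrable_norm ig).
- exact: (integrableZl _ C i1).
Qed.

Lemma ae_integrable_norm1 (C : R) :
  ae_integrable mu (fun t => C * (1 + \int[kappa t]_z `|z|)).
Proof.
have [G iG nG] := ae_integrable_moment.
exists (fun t => C * (1 + G t)); last first.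
  by apply: negligibleS nG => t /=; apply: contra_not => ->.
have i1 : mu.-integrable setT (cst 1%E) by exact: finite_measure_integrable_cst.
exact: (integrableZl _ C (integrableD _ i1 iG)).
Qed.

End kernel.

(** An induction principle in place of finite subcovers. If [P K] failed, the sets whose complement
    in [K] satisfies [P] would form a proper filter containing [K]; a cluster point in [K]
    contradicts the local hypothesis. *)
Lemma compact_set_ind (X : topologicalType) (K : set X) (P : set X -> Prop) :
  compact K -> P set0 -> (forall A B, A `<=` B -> P B -> P A) ->
  (forall A B, P A -> P B -> P (A `|` B)) ->
  (forall x, K x -> exists2 U, nbhs x U & P U) -> P K.
Proof.
move=> cK P0 PS PU PK; apply: contrapT => nPK.
pose F : set_system X := [set S | P (K `\` S)].
have FF : ProperFilter F.
  split; first by rewrite /F /= setD0.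
  split; first by rewrite /F /= setDT.
  - by move=> A B FA FB; rewrite /F /= setDIr; exact: PU.
  - by move=> A B AB FA; apply: PS FA; exact: setDS.
have [|x [Kx clx]] := cK F FF; first by rewrite /F /= setDv.
have [U xU PUU] := PK _ Kx.
have [|y [+ Uy]] := clx (~` U) U _ xU; last exact.
by rewrite /F /=; apply: PS PUU => y [_ /contrapT].
Qed.

(** * Kernels over the torus and integrands depending on the torus variable *)

Section torus_kernel.
Context (R : realType) (d m : nat).
Local Notation Z := (torus R d).
Local Notation E := 'rV[R]_m.

Lemma torus_measurable_open (U : set Z) : open U -> measurable U.
Proof. by move=> oU; exact: sub_sigma_algebra. Qed.

Lemma torus_proj_continuous : continuous (@torus_proj R d).
Proof. exact: pi_continuous. Qed.

Lemma torus_compact : compact [set: Z].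
Proof.
rewrite (_ : setT = @torus_proj R d @`
    [set v : 'rV[R]_d | forall i, `[0, 1]%classic (v ord0 i)]).
  apply: continuous_compact.
    apply: continuous_subspaceT; exact: torus_proj_continuous.
  by apply: (@rV_compact R d (fun=> `[0, 1]%classic)) => i; exact: segment_compact.
apply/seteqP; split => // xi _; pose v := repr xi : 'rV[R]_d.
(* Subtracting the floors moves a representative into the closed unit cube without changing its
   class. *)
exists (\row_i (v ord0 i - (Num.floor (v ord0 i))%:~R)).
  move=> i /=; rewrite mxE in_itv/= subr_ge0 floor_le_tmp.
  by have /ltW := floorD1_gt (v ord0 i); rewrite intrD lerBlDl.
have <- : torus_proj v = xi by exact: reprK.
apply/(@eqquotP _ (torus_rel R d) (torus R d)) => /=.
apply/forallP => i; rewrite mxE addrAC subrr sub0r rpredN.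
exact: intr_int.
Qed.

(** Continuity in the torus variable is uniform in [z] up to the weight [1 + |z|], which is what the
    moment bound can absorb. Both [h] and its recession function are shown to belong to this
    class. *)
Record admissible (g : Z -> E -> R) : Prop := {
  admissible_continuous : forall xi, continuous (g xi) ;
  admissible_growth : exists C, forall xi z, `|g xi z| <= C * (1 + `|z|) ;
  admissible_uniform : forall xi0 e, 0 < e ->
    \forall xi \near xi0, forall z, `|g xi z - g xi0 z| <= e * (1 + `|z|) }.

Lemma admissible_linear_growth g xi : admissible g -> linear_growth (g xi).
Proof.
move=> ag; split; first exact: admissible_continuous.
by have [C gC] := admissible_growth ag; exists C.
Qed.

Lemma linear_growth_admissible g : linear_growth g -> admissible (fun=> g).
Proof.
move=> [cg [C gC]]; split=> //; first by exists C.
by move=> xi0 e e0; near=> xi => z; rewrite subrr normr0 mulr_ge0 ?addr_ge0// ltW.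
Unshelve. all: by end_near. Qed.

Variables (mu : probability Z R) (kappa : Z -> probability E R).
Hypothesis kappa_weakstar : weakstar_measurable mu setT (C0 R E) kappa.
Hypothesis kappa_moment : (\int[mu]_t \int[kappa t]_z (enorm z)%:E < +oo)%E.

Lemma ae_measurable_patch (S : set Z) (f g : Z -> R) : measurable S ->
  ae_measurable mu setT f -> ae_measurable mu setT g ->
  ae_measurable mu setT (fun t => f t * \1_S t + g t * \1_(~` S) t).
Proof.
move=> mS [f' mf' nf'] [g' mg' ng'].
exists (fun t => f' t * \1_S t + g' t * \1_(~` S) t).
  apply: measurable_funD; apply: measurable_funM => //.
  exact/measurable_indic/measurableC.
apply: negligibleS (negligibleU nf' ng') => t /= [_].
by apply: contra_notP => /not_orP[/not_andP[//|/contrapT->] /not_andP[//|/contrapT->]].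
Qed.

(** Near [xi0], freezing the integrand at [g xi0] costs at most [e] times the integral of the
    weight. Compactness of the torus glues finitely many frozen integrals into one approximation,
    and [e] tends to zero. *)
Lemma ae_measurable_admissible g : admissible g ->
  ae_measurable mu setT (fun xi => \int[kappa xi]_z g xi z).
Proof.
move=> ag; pose F xi := \int[kappa xi]_z `|z|.
have F0 xi : 0 <= F xi by apply: Rintegral_ge0.
have approx e : 0 < e -> exists2 phi, ae_measurable mu setT phi &
    forall xi, moment_finite kappa xi ->
      `|\int[kappa xi]_z g xi z - phi xi| <= e * (1 + F xi).
  (* The measurable superset [S'] is kept because sets met in the induction may fail to be
     measurable, while gluing requires it. *)
  move=> e0; pose P (S : set Z) := exists S' phi, [/\ S `<=` S', measurable S',
    ae_measurable mu setT phi & forall xi, S' xi -> moment_finite kappa xi ->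
      `|\int[kappa xi]_z g xi z - phi xi| <= e * (1 + F xi)].
  suff [S' [phi [TS' _ mphi phiP]]] : P setT.
    by exists phi => // xi; apply: phiP; exact: TS'.
  apply: compact_set_ind; first exact: torus_compact.
  - exists set0, (cst 0); split => //; exists (cst 0) => //.
    by apply: negligibleS (negligible_set0 mu) => t [].
  - move=> A B AB [S' [phi [BS' ? ? ?]]]; exists S', phi; split => //.
    exact: subset_trans BS'.
  - move=> A B [S1 [f1 [AS1 mS1 mf1 f1P]]] [S2 [f2 [BS2 mS2 mf2 f2P]]].
    exists (S1 `|` S2), (fun t => f1 t * \1_S1 t + f2 t * \1_(~` S1) t); split.
    + exact: setUSS.
    + exact: measurableU.
    + exact: ae_measurable_patch.
    + move=> xi S12 fxi; rewrite !indicE in_setC.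
      case: (boolP (xi \in S1)) => xiS1 /=.
        by rewrite mulr1 mulr0 addr0 f1P//; move: xiS1; rewrite inE.
      rewrite mulr0 mulr1 add0r f2P//; case: S12 => // xS1.
      by move: xiS1; rewrite notin_setE.
  move=> xi0 _; have := admissible_uniform ag xi0 e0.
  rewrite nbhsE /= => -[U [oU Uxi0] UP].
  exists U; first by exists U.
  exists U, (fun xi => \int[kappa xi]_z g xi0 z); split => //.
  - exact: torus_measurable_open.
  - exact: (ae_measurable_Rintegral_kernel kappa_weakstar kappa_moment
      (admissible_linear_growth xi0 ag)).
  move=> xi Uxi fxi.
  have i0 := integrable_linear_growth (admissible_linear_growth xi0 ag) fxi.
  have i1 := integrable_linear_growth (admissible_linear_growth xi ag) fxi.
  rewrite -RintegralB//; apply: norm_Rintegral_kernel => //; last exact: UP.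
  by move=> z; apply: (@continuousB _ R^o E (g xi) (g xi0));
    exact: admissible_continuous.
have e_gt0 n : 0 < n.+1%:R^-1 :> R by rewrite invr_gt0.
have /choice[phi phiP] : forall n, exists phi, ae_measurable mu setT phi /\
    forall xi, moment_finite kappa xi ->
      `|\int[kappa xi]_z g xi z - phi xi| <= n.+1%:R^-1 * (1 + F xi).
  by move=> n; have [phi ? ?] := approx _ (e_gt0 n); exists phi.
apply: (@ae_measurable_cvg _ _ _ _ phi); first by move=> n; exact: (phiP n).1.
apply: filterS (moment_finite_ae kappa_weakstar kappa_moment) => xi fxi.
apply/cvgrPdist_le => e e0.
have : (n.+1%:R^-1 * (1 + F xi)) @[n --> \oo] --> 0 * (1 + F xi).
  by apply: cvgM; [exact: cvg_harmonic|exact: cvg_cst].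
rewrite mul0r => /cvgrPdist_le /(_ _ e0); apply: filterS => n.
rewrite sub0r normrN ger0_norm ?mulr_ge0 ?addr_ge0// => ne.
exact: le_trans ((phiP n).2 _ fxi) ne.
Qed.

Lemma ae_integrable_admissible g : admissible g ->
  ae_integrable mu (fun xi => \int[kappa xi]_z g xi z).
Proof.
move=> ag; have [C gC] := admissible_growth ag.
apply: (ae_measurable_integrable (ae_measurable_admissible ag)
  (ae_integrable_norm1 kappa_weakstar kappa_moment C)).
apply: filterS (moment_finite_ae kappa_weakstar kappa_moment) => xi fxi.
by apply: norm_Rintegral_kernel => //; exact: admissible_continuous.
Qed.

Lemma linear_growth_coord i : linear_growth (fun z : E => z ord0 i).
Proof.
split; first by move=> z; exact: coord_continuous.
by exists 1 => z; rewrite mul1r (le_trans (norm_coord_le z i))// lerDr.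
Qed.

(** The minorant is integrated over [E] and then over [V], after all slice integrals have been
    replaced by integrable representatives so that linearity applies. *)
Lemma le_affine_Rintegral_kernel g (V : set Z) (a : E) (beta delta : R) :
  admissible g -> measurable V ->
  (forall xi z, V xi -> dotp a z + beta - delta * (1 + `|z|) <= g xi z) ->
  dotp a (\row_i \int[mu]_(xi in V) (\int[kappa xi]_z z ord0 i)) +
    beta * fine (mu V) - delta * \int[mu]_(xi in V) (\int[kappa xi]_z (1 + `|z|))
  <= \int[mu]_(xi in V) (\int[kappa xi]_z g xi z).
Proof.
move=> ag mV Vg.
have [G iG nG] := ae_integrable_admissible ag.
have [w iw nw] := ae_integrable_admissible
  (linear_growth_admissible (@linear_growth_norm1 R m)).
have /choice[f fP] : forall i, exists f, mu.-integrable setT (EFin \o f) /\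
    mu.-negligible [set xi | \int[kappa xi]_z z ord0 i <> f xi].
  move=> i; have [f ? ?] := ae_integrable_admissible
    (linear_growth_admissible (linear_growth_coord i)).
  by exists f.
rewrite (eq_Rintegral_ae _ nG) (eq_Rintegral_ae _ nw).
rewrite (_ : (\row_i _) = \row_i \int[mu]_(xi in V) f i xi); last first.
  by apply/rowP => i; rewrite !mxE (eq_Rintegral_ae _ (fP i).2).
have mu_fin : (mu setT < +oo)%E.
  by rewrite (@probability_setT _ _ _ mu) ltry.
have kappa_fin xi : (kappa xi setT < +oo)%E.
  by rewrite (@probability_setT _ _ _ (kappa xi)) ltry.
have [iA <-] := Rintegral_affine mu_fin a beta delta mV (fun i => (fP i).1) iw.
apply: le_Rintegral_ae => //.
(* The exceptional sets of the [m] coordinates are written as a countable union in which indices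
   from [m] on contribute nothing. *)
have nf : mu.-negligible (\bigcup_i [set xi | exists j : 'I_m, j = i :> nat /\
    \int[kappa xi]_z z ord0 j <> f j xi]).
  apply: negligible_bigcup => k; case: (ltnP k m) => km; last first.
    apply: negligibleS (negligible_set0 mu) => xi [j [jk _]].
    by move: (ltn_ord j); rewrite jk ltnNge km.
  apply: negligibleS (fP (Ordinal km)).2 => xi /= [j [jk]].
  by rewrite (_ : j = Ordinal km)//; exact: val_inj.
have := negligibleU (moment_finite_ae kappa_weakstar kappa_moment)
  (negligibleU nG (negligibleU nw nf)).
apply: negligibleS => xi /=; apply: contra_notP.
move=> /not_orP[/contrapT fxi] /not_orP[/contrapT <-] /not_orP[/contrapT <-] nfx Vxi.
have -> : \row_i f i xi = \row_i \int[kappa xi]_z z ord0 i.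
  apply/rowP => i; rewrite !mxE; apply: contra_notP nfx => fi.
  by exists i => //; exists i; split => // /esym.
have iz i := integrable_linear_growth (linear_growth_coord i) fxi.
have i1 := integrable_linear_growth (@linear_growth_norm1 R m) fxi.
have [iB EB] := Rintegral_affine (kappa_fin xi) a beta delta measurableT iz i1.
have E1 : fine (kappa xi setT) = 1 by rewrite (@probability_setT _ _ _ (kappa xi)).
rewrite E1 mulr1 in EB; rewrite -EB.
apply: le_Rintegral => //.
  exact: integrable_linear_growth (admissible_linear_growth xi ag) fxi.
move=> z _; rewrite (_ : \row_i z ord0 i = z) ?Vg//.
by apply/rowP => i; rewrite mxE.
Qed.

End torus_kernel.

(** * Convex functions and their recession functions *)

Section convex.
Context (R : realType) (m : nat).
Local Notation E := 'rV[R]_m.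

Definition is_convex (f : E -> R) := forall t u v, 0 <= t <= 1 ->
  f (t *: u + (1 - t) *: v) <= t * f u + (1 - t) * f v.

Definition is_lipschitz (C : R) (f : E -> R) :=
  forall u v, `|f u - f v| <= C * `|u - v|.

Lemma convex_functionP (f : E -> R) :
  convex_function [set: E] f -> is_convex f.
Proof.
move=> cf t u v t01.
have /andP[t0 t1] := t01.
exact: (cf (@Itv01 R t t0 t1) u v (in_setT _) (in_setT _)).
Qed.

Lemma dotpC (u v : E) : dotp u v = dotp v u.
Proof. by apply: eq_bigr => i _; rewrite mulrC. Qed.

Lemma dotpDl (u v w : E) : dotp (u + v) w = dotp u w + dotp v w.
Proof. by rewrite /dotp -big_split; apply: eq_bigr => i _; rewrite mxE mulrDl. Qed.

Lemma dotpZl c (u w : E) : dotp (c *: u) w = c * dotp u w.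
Proof. by rewrite /dotp big_distrr /=; apply: eq_bigr => i _; rewrite mxE mulrA. Qed.

Lemma dotpDr (u v w : E) : dotp w (u + v) = dotp w u + dotp w v.
Proof. by rewrite dotpC dotpDl !(dotpC w). Qed.

Lemma dotpZr c (u w : E) : dotp w (c *: u) = c * dotp w u.
Proof. by rewrite dotpC dotpZl (dotpC w). Qed.

Lemma sqr_norm_le_dotp (u : E) : `|u| ^+ 2 <= dotp u u.
Proof.
have u0 : 0 <= dotp u u by apply: sumr_ge0 => i _; rewrite -expr2 sqr_ge0.
by rewrite -[leRHS]sqr_sqrtr// lerXn2r ?nnegrE ?sqrtr_ge0//; exact: norm_le_enorm.
Qed.

Lemma lipschitz_continuous C (f : E -> R) : is_lipschitz C f -> continuous f.
Proof.
move=> lf z; apply/(@cvgrPdist_le _ _ _ _ (nbhs_filter z)) => e e0.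
have C0 : 0 < `|C| + 1 by rewrite ltr_pwDr.
have := nbhsx_ballx z _ (divr_gt0 e0 C0).
apply: filterS => u; rewrite -ball_normE /= => /ltW; rewrite ler_pdivlMr// => uz.
apply: le_trans (lf _ _) (le_trans _ uz).
by rewrite mulrC ler_wpM2l// (le_trans (ler_norm C))// lerDl.
Qed.

(* The exact subgradient at [w] is replaced by the gradient at the minimiser of
   a quadratic penalisation of [f] around [w], which avoids Hahn-Banach. *)
Lemma affine_minorant (f : E -> R) C w e : is_convex f -> is_lipschitz C f ->
  0 < e -> exists a beta, (forall z, dotp a z + beta <= f z) /\
    f w <= dotp a w + beta + e.
Proof.
move=> cf lf0 e0.
have [{lf0}C C0 lf] : exists2 C, 0 <= C & is_lipschitz C f.
  exists `|C| => // u v; apply: le_trans (lf0 u v) _.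
  by rewrite ler_wpM2r// ler_norm.
(* [C <= k] makes the minimiser over the unit ball a global one, and [C ^+ 2 <= k * e] gives
   [C * |u0| <= e]. *)
pose k := C + 1 + C ^+ 2 / e.
have C2e : 0 <= C ^+ 2 / e by rewrite divr_ge0 ?sqr_ge0 ?ltW.
have k0 : 0 < k by rewrite /k; lra.
have kC : C <= k by rewrite /k; lra.
have ke : C ^+ 2 <= k * e.
  by rewrite -ler_pdivrMr// /k; lra.
pose Phi u := f (w + u) + k * dotp u u.
have cPhi : continuous Phi.
  move=> u; apply: (@continuousD _ R^o E (fun u => f (w + u)) (fun u => k * dotp u u)).
    apply: (@continuous_comp E E R (fun u => w + u) f).
      by apply: (@continuousD _ E E (cst w) id); [exact: cst_continuous|exact: cvg_id].
    exact: (lipschitz_continuous lf).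
  apply: (@continuousM R E (cst k) (fun u => dotp u u)); first exact: cst_continuous.
  exact: (@cvg_dotp _ _ _ (nbhs u) id id u u).
have [|u0 _ minPhi] := EVT_min_rV _ (@compact_norm_le R m 1) (continuous_subspaceT cPhi).
  by exists 0; rewrite /= normr0.
have Phi0 : Phi 0 = f w.
  by rewrite /Phi addr0 -{1}(scale0r (0 : E)) dotpZl mul0r mulr0 addr0.
have le0 : Phi u0 <= f w.
  by rewrite -Phi0; apply: minPhi; rewrite inE /= normr0.
have {}minPhi u : Phi u0 <= Phi u.
  have [u1|u1] := leP `|u| 1; first by apply: minPhi; rewrite inE.
  apply: le_trans le0 _; rewrite /Phi.
  have := lf w (w + u); rewrite opprD addrA subrr sub0r normrN ler_norml.
  move=> /andP[_ fu]; have := ler_wpM2l (ltW k0) (sqr_norm_le_dotp u).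
  have : C * `|u| <= k * `|u| ^+ 2.
    apply: ler_pM => //; rewrite expr2 ler_peMr// ltW//.
  lra.
have u0C : C * `|u0| <= e.
  have kuC : k * `|u0| ^+ 2 <= C * `|u0|.
    have := lf w (w + u0); rewrite opprD addrA subrr sub0r normrN ler_norml.
    move=> /andP[_ fu]; have := ler_wpM2l (ltW k0) (sqr_norm_le_dotp u0).
    by move: le0; rewrite /Phi; lra.
  have [->|u00] := eqVneq `|u0| 0; first by rewrite mulr0 ltW.
  have u0p : 0 < `|u0| by rewrite lt_neqAle eq_sym u00 normr_ge0.
  rewrite expr2 mulrA ler_pM2r// in kuC.
  rewrite -(ler_pM2l k0) mulrCA (le_trans _ ke)//.
  by rewrite expr2 ler_wpM2l.
pose p : E := w + u0.
have sub v : f p - 2 * k * dotp u0 (v - p) <= f v.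
  rewrite -subr_ge0; set D := f v - _.
  have D0 : 0 <= dotp (v - p) (v - p).
    by apply: le_trans (sqr_norm_le_dotp _); rewrite sqr_ge0.
  (* Minimality is tested at a fraction [t] of the way from [p] to [v]. By convexity of [f],
     division by [t] leaves a quadratic remainder of order [t], which is then sent to zero. *)
  suff H t : 0 < t -> t <= 1 -> 0 <= D + t * (k * dotp (v - p) (v - p)).
    apply/ler_addgt0Pr => e' e'0.
    pose K := k * dotp (v - p) (v - p) + e' + 1.
    have kd0 : 0 <= k * dotp (v - p) (v - p) by rewrite mulr_ge0// ltW.
    have K0 : 0 < K by rewrite /K; lra.
    apply: le_trans (H (e' / K) _ _) _; first exact: divr_gt0.
      by rewrite ler_pdivrMr// mul1r /K; lra.
    rewrite lerD2l mulrAC ler_pdivrMr// ler_pM2l// /K; lra.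
  move=> t0 t1; rewrite -(pmulr_rge0 _ t0).
  have := minPhi (u0 + t *: (v - p)); rewrite /Phi.
  have -> : w + (u0 + t *: (v - p)) = t *: v + (1 - t) *: p.
    by rewrite addrA -/p scalerBr scalerBl scale1r addrCA addrA.
  have := cf t v p; rewrite t1 (ltW t0) => /(_ isT).
  have -> q : dotp (u0 + t *: q) (u0 + t *: q) =
      dotp u0 u0 + 2 * t * dotp u0 q + t ^+ 2 * dotp q q.
    rewrite !dotpDl !dotpDr !dotpZl !dotpZr (dotpC q u0); lra.
  rewrite /D -/p; move: (f (_ + _)) (f v) (f p) (dotp u0 u0) (dotp u0 _) (dotp _ _).
  by move=> x1 x2 x3 x4 x5 x6; nra.
(* The slope is minus the gradient of the penalty at [u0]. The affine function is at least [f p] at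
   [w], and [f w] exceeds [f p] by at most [C * |u0| <= e]. *)
exists (- (2 * k) *: u0), (f p + 2 * k * dotp u0 p); split => [v|].
  have := sub v; rewrite dotpZl dotpDr -(scaleN1r p) dotpZr; lra.
have := lf w p; rewrite /p opprD addrA subrr sub0r normrN ler_norml => /andP[_ fu].
rewrite dotpZl dotpDr.
have := mulr_ge0 (ltW k0) (le_trans (sqr_ge0 _) (sqr_norm_le_dotp u0)); lra.
Qed.

End convex.

(** * Growth, continuity and homogeneity of a convex integrand and its recession function *)

Section recession.
Context (R : realType) (d m : nat).
Local Notation Z := (torus R d).
Local Notation E := 'rV[R]_m.
Variables (h hinf : Z -> E -> R).
Hypothesis h_continuous : continuous (fun q : Z * E => h q.1 q.2).
Hypothesis h_convex : forall xi, is_convex (h xi).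
Hypothesis h_recession : forall (xi0 : Z) (z : E) (e : R), 0 < e ->
  \forall xi \near xi0 & t \near +oo, `|h xi (t *: z) / t - hinf xi0 z| <= e.

Lemma recession_near (xi0 : Z) (z : E) (e : R) : 0 < e ->
  exists U T, [/\ nbhs xi0 U, 1 <= T &
  forall xi t, U xi -> T <= t -> `|h xi (t *: z) / t - hinf xi0 z| <= e].
Proof.
move=> /(h_recession xi0 z)[[U W] /= [xU [M [_ MW]]] UW].
exists U, (Num.max 1 (M + 1)); split => //; first by rewrite le_max lexx.
move=> xi t Uxi; rewrite ge_max => /andP[_ Mt]; apply: (UW (xi, t)); split => //=.
by apply: MW; apply: lt_le_trans Mt; rewrite ltrDl.
Qed.

Lemma h_near (xi0 : Z) (z0 : E) (e : R) : 0 < e ->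
  \forall z \near z0 & xi \near xi0, `|h xi z - h xi0 z0| <= e.
Proof.
move=> e0; have /cvgrPdist_le/(_ _ e0) := @h_continuous (xi0, z0).
move=> [[U W] /= [xU zW] UW]; exists (W, U) => //= -[z xi] /= [Wz Uxi].
by rewrite distrC; exact: (UW (xi, z)).
Qed.

Lemma h_near1 (xi0 : Z) (z0 : E) (e : R) : 0 < e ->
  \forall xi \near xi0, `|h xi z0 - h xi0 z0| <= e.
Proof.
move=> /(h_near xi0 z0)[[W U] /= [zW xU] UW].
by apply: filterS xU => xi Uxi; apply: (UW (z0, xi)); split => //=; exact: nbhs_singleton.
Qed.

(** Near each [xi0] the recession limit controls the far part of the ray, and convexity between the
    origin and a far point controls the rest. Compactness of the torus makes the constant
    uniform. *)
Lemma ray_growth z : exists2 C, 0 <= C &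
  forall xi t, 0 <= t -> h xi (t *: z) <= C * (1 + t).
Proof.
have /compact_near_coveringP := @torus_compact R d.
move=> /(_ R (pinfty_nbhs R) (fun C xi => 0 <= C /\
  forall t, 0 <= t -> h xi (t *: z) <= C * (1 + t))) H.
suff [C [CR CP]] : \forall C \near +oo, setT `<=` (fun xi : Z => 0 <= C /\
    forall t, 0 <= t -> h xi (t *: z) <= C * (1 + t)).
  have CC : C < C + 1 by rewrite ltrDl.
  exists (C + 1); first by have [] := CP _ CC (point : Z) I.
  by move=> xi; have [] := CP _ CC xi I.
apply: H => xi0 _.
have [U [T [xU T1 UT]]] := recession_near xi0 z ltr01.
pose C0 := `|hinf xi0 z| + 1 + (`|h xi0 0| + 1).
exists (U `&` [set xi | `|h xi 0 - h xi0 0| <= 1], [set C | C0 <= C]) => /=.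
  split; first by apply: filterI => //; exact: h_near1.
  exists C0; split; first exact: num_real.
  by move=> C /ltW.
move=> [xi C] /= [[Uxi h0] CC0].
have Cge0 : 0 <= C by apply: le_trans CC0; rewrite /C0 !addr_ge0.
have hT t : T <= t -> h xi (t *: z) <= C * t.
  move=> Tt; have t0 : 0 < t by apply: lt_le_trans Tt; apply: lt_le_trans T1.
  have := UT _ _ Uxi Tt; rewrite ler_norml => /andP[_].
  rewrite lerBlDr ler_pdivrMr// => /le_trans; apply; rewrite ler_wpM2r//; first exact: ltW.
  have := ler_norm (hinf xi0 z); have := normr_ge0 (h xi0 0); rewrite /C0 in CC0; lra.
split=> // t t0; have [Tt|/ltW tT] := leP T t.
  by apply: le_trans (hT _ Tt) _; rewrite ler_wpM2l// lerDr.
have T0 : 0 < T by apply: lt_le_trans T1.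
have s0 : 0 <= t / T by rewrite divr_ge0// ltW.
have s1 : t / T <= 1 by rewrite ler_pdivrMr// mul1r.
have := @h_convex xi (t / T) (T *: z) 0; rewrite s0 s1 => /(_ isT).
rewrite scaler0 addr0 scalerA divfK ?gt_eqF// => /le_trans; apply.
have h0C : h xi 0 <= C.
  have := ler_norm (h xi0 0); have := normr_ge0 (hinf xi0 z).
  by move: h0; rewrite ler_norml => /andP[_]; rewrite /C0 in CC0; lra.
have := ler_wpM2l s0 (hT _ (lexx T)); rewrite mulrCA divfK ?gt_eqF// => hT'.
have s1' : 0 <= 1 - t / T by rewrite subr_ge0.
have := ler_wpM2l s1' h0C; have := mulr_ge0 s0 Cge0; lra.
Qed.

(** Growth along the positive and negative coordinate rays spreads by convexity, one coordinate at a
    time: a vector is the midpoint of twice its new component and twice the remaining ones. *)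
Lemma upper_growth : exists2 C, 0 <= C & forall xi z, h xi z <= C * (1 + `|z|).
Proof.
suff [C C0 CP] : exists2 C, 0 <= C & forall xi (v : E),
    h xi (\sum_(i <- index_enum 'I_m) v ord0 i *: delta_mx ord0 i) <= C * (1 + `|v|).
  by exists C => // xi v; rewrite [v in h xi v]row_sum_delta; exact: CP.
elim: (index_enum _) => [|i s [C C0 IH]].
  have [C C0 CP] := ray_growth 0; exists C => // xi v; rewrite big_nil.
  have := CP xi 0 (lexx 0); rewrite scaler0 addr0 mulr1 => /le_trans; apply.
  by rewrite ler_peMr// lerDl.
have [C1 C10 C1P] := ray_growth (delta_mx ord0 i).
have [C2 C20 C2P] := ray_growth (- delta_mx ord0 i).
exists (C + C1 + C2); first by rewrite !addr_ge0.
move=> xi v; rewrite big_cons.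
have e1 : h xi ((2 * v ord0 i) *: delta_mx ord0 i) <= (C1 + C2) * (1 + 2 * `|v|).
  have vi := norm_coord_le v i; have n0 := normr_ge0 v.
  have [v0|/ltW v0] := leP 0 (v ord0 i).
    rewrite ger0_norm// in vi.
    have := C1P xi (2 * v ord0 i) (mulr_ge0 (ler0n _ 2) v0) => /le_trans; apply.
    by apply: ler_pM; rewrite ?addr_ge0 ?mulr_ge0// ?lerDl// lerD2l ler_pM2l.
  rewrite ler0_norm// in vi.
  have v0' : 0 <= 2 * - v ord0 i by rewrite mulr_ge0// oppr_ge0.
  have -> : (2 * v ord0 i) *: delta_mx ord0 i =
      (2 * - v ord0 i) *: - delta_mx ord0 i :> E.
    by rewrite mulrN scalerN scaleNr opprK.
  have := C2P xi _ v0' => /le_trans; apply.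
  by apply: ler_pM; rewrite ?addr_ge0// ?lerDr// lerD2l ler_pM2l.
have e2 := IH xi (2 *: v); rewrite normrZ ger0_norm// in e2.
have := @h_convex xi (2^-1) ((2 * v ord0 i) *: delta_mx ord0 i)
  (\sum_(j <- s) (2 *: v) ord0 j *: delta_mx ord0 j).
have -> : (0 <= (2^-1 : R) <= 1) by apply/andP; split; lra.
have -> : 1 - 2^-1 = 2^-1 :> R by lra.
rewrite scalerA mulKf//.
have -> : 2^-1 *: \sum_(j <- s) (2 *: v) ord0 j *: delta_mx ord0 j =
    \sum_(j <- s) v ord0 j *: delta_mx ord0 j :> E.
  by rewrite scaler_sumr; apply: eq_bigr => j _; rewrite mxE scalerA mulKf.
move=> /(_ isT) /le_trans; apply.
by have n0 := normr_ge0 v; nra.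
Qed.

(** Along the ray from [u] through [v], convexity bounds the increment by the slope at infinity, and
    linear growth bounds that slope by [C]. *)
Lemma uniform_lipschitz : exists2 C, 0 <= C & forall xi, is_lipschitz C (h xi).
Proof.
have [C C0 hC] := upper_growth; exists C => // xi.
suff H u v : h xi v - h xi u <= C * `|v - u|.
  by move=> u v; rewrite ler_norml lerNl opprB H andbT distrC H.
apply/ler_addgt0Pr => e e0.
(* [K] collects the terms that do not grow with [s]; this choice of [s] makes [K / s] at most
   [e]. *)
pose K := C * (1 + `|u|) - h xi u; pose s := 1 + `|K| / e.
have Ke0 : 0 <= `|K| / e by rewrite divr_ge0// ltW.
have s1 : 1 <= s by rewrite /s lerDl.
have s0 : 0 < s by apply: lt_le_trans s1.
have := @h_convex xi s^-1 (u + s *: (v - u)) u.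
rewrite invr_ge0 (ltW s0) invf_le1// s1 => /(_ isT).
have -> : s^-1 *: (u + s *: (v - u)) + (1 - s^-1) *: u = v.
  rewrite scalerDr scalerA mulVf ?gt_eqF// scale1r scalerBl scale1r.
  by rewrite addrC addrA subrK addrC subrK.
have := hC xi (u + s *: (v - u)).
have : `|u + s *: (v - u)| <= `|u| + s * `|v - u|.
  by apply: le_trans (ler_normD _ _) _; rewrite normrZ (ger0_norm (ltW s0)).
move: (`|u + _|) (h xi (u + _)) => n1 h1 n1P h1P hv.
have {}h1P : h1 <= C * (1 + (`|u| + s * `|v - u|)).
  by apply: le_trans h1P _; rewrite ler_wpM2l// lerD2l.
have si0 : 0 <= s^-1 by rewrite invr_ge0 ltW.
have : s^-1 * h1 <= s^-1 * (C * (1 + `|u|)) + C * `|v - u|.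
  apply: le_trans (ler_wpM2l si0 h1P) _.
  by rewrite addrA mulrDr mulrDr [s^-1 * (C * (s * _))]mulrCA mulKf ?gt_eqF.
have : s^-1 * K <= e.
  rewrite mulrC ler_pdivrMr// (le_trans (ler_norm K))// /s mulrDr mulr1 mulrCA divff ?gt_eqF//.
  by rewrite mulr1 lerDr ltW.
by rewrite /K; lra.
Qed.

(** Bounded [z] are handled by joint continuity on a compact ball. Large [z] are handled by the
    recession limit, made uniform over directions by compactness of the unit ball and the Lipschitz
    bound. *)
Lemma h_admissible : admissible h.
Proof.
have [C C0 hC] := uniform_lipschitz.
split; first by move=> xi; exact: lipschitz_continuous (hC xi).
- have /compact_near_coveringP := @torus_compact R d.
  move=> /(_ R (pinfty_nbhs R) (fun B xi => `|h xi 0| <= B)) [xi0 _|B [_ BP]].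
    exists ([set xi | `|h xi 0 - h xi0 0| <= 1], [set B | `|h xi0 0| + 1 <= B]) => /=.
      split; first exact: h_near1.
      exists (`|h xi0 0| + 1); split; first exact: num_real.
      by move=> B /ltW.
    move=> [xi B] /= [h0 hB]; apply: le_trans hB.
    by rewrite -lerBlDl (le_trans (lerB_dist _ _)).
  exists (`|B + 1| + C) => xi z.
  have h0 : `|h xi 0| <= `|B + 1|.
    by apply: le_trans (BP _ _ xi I) (ler_norm _); rewrite ltrDl.
  have := hC xi z 0; rewrite subr0 => hz.
  have hn : `|h xi z| <= `|h xi 0| + `|h xi z - h xi 0|.
    by rewrite -{1}(subrK (h xi 0) (h xi z)) addrC ler_normD.
  have := mulr_ge0 (normr_ge0 (B + 1)) (normr_ge0 z); lra.
move=> xi0 e e0.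
have C1 : 0 < 4 * (C + 1) by rewrite mulr_gt0// ltr_wpDl.
have [U1 [T1 [xU1 T10 UT1]]] : exists U T, [/\ nbhs xi0 U, 0 < T &
    forall xi t u, U xi -> T <= t -> `|u| <= 1 ->
      `|h xi (t *: u) - h xi0 (t *: u)| <= e * t].
  have /compact_near_coveringP := @compact_norm_le R m 1.
  move=> /(_ _ (filter_prod (nbhs xi0) (pinfty_nbhs R))
    (fun q u => `|h q.1 (q.2 *: u) - h xi0 (q.2 *: u)| <= e * q.2)) [].
    move=> u0 _; have [|U [T [xU T1 UT]]] := @recession_near xi0 u0 (e / 4).
      by rewrite divr_gt0.
    (* On this ball each of the two Lipschitz errors is at most [e / 4 * t]; comparing both slices
       with [hinf xi0 u0] costs the remaining [e / 2 * t]. *)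
    exists (ball u0 (e / (4 * (C + 1))), U `*` [set t | T <= t]) => /=.
      split; first by apply: nbhsx_ballx; rewrite divr_gt0.
      exists (U, [set t | T <= t]) => //=; split => //.
      by exists T; split; [exact: num_real|move=> t /ltW].
    move=> [u [xi t]] /= [uu0 [Uxi Tt]].
    have t0 : 0 < t by apply: lt_le_trans Tt; apply: lt_le_trans T1.
    have Cu : C * `|t *: u - t *: u0| <= e / 4 * t.
      rewrite -scalerBr normrZ (ger0_norm (ltW t0)) mulrCA [leRHS]mulrC ler_pM2l//.
      move: uu0; rewrite -ball_normE /= distrC ltr_pdivlMr// => uu0.
      rewrite ler_pdivlMr//; have := normr_ge0 (u - u0); nra.
    have h1 := le_trans (hC xi (t *: u) (t *: u0)) Cu.
    have h2 := le_trans (hC xi0 (t *: u) (t *: u0)) Cu.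
    have h3 := UT _ _ Uxi Tt; have h4 := UT _ _ (nbhs_singleton xU) Tt.
    have h5 : `|h xi (t *: u0) - h xi0 (t *: u0)| <= e / 2 * t.
      rewrite -ler_pdivrMr// (_ : _ / t =
        `|h xi (t *: u0) / t - h xi0 (t *: u0) / t|); last first.
        by rewrite -mulrBl normf_div (ger0_norm (ltW t0)).
      move: h3 h4; rewrite !ler_norml => /andP[? ?] /andP[? ?].
      by apply/andP; split; lra.
    move: h1 h2 h5; rewrite !ler_norml => /andP[? ?] /andP[? ?] /andP[? ?].
    by apply/andP; split; lra.
  move=> [U W] /= [xU [M [_ MW]]] UW; exists U, (Num.max 1 (M + 1)); split => //.
    by rewrite lt_max ltr01.
  move=> xi t u Uxi; rewrite ge_max => /andP[_ Mt] u1; apply: (UW (xi, t)) => //.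
  by split => //=; apply: MW; apply: lt_le_trans Mt; rewrite ltrDl.
have xU2 : \forall xi \near xi0, [set z : E | `|z| <= T1] `<=`
    (fun z => `|h xi z - h xi0 z| <= e).
  have /compact_near_coveringP := @compact_norm_le R m T1.
  move=> /(_ Z (nbhs xi0) (fun xi z => `|h xi z - h xi0 z| <= e)); apply => z0 _.
  have [|[W U] /= [zW xU] UW] := @h_near xi0 z0 (e / 2); first by rewrite divr_gt0.
  exists (W, U) => //= -[z xi] /= [Wz Uxi].
  have h1 := UW (z, xi) (conj Wz Uxi).
  have h2 := UW (z, xi0) (conj Wz (nbhs_singleton xU)).
  move: h1 h2; rewrite /= !ler_norml => /andP[? ?] /andP[? ?].
  by apply/andP; split; lra.
apply: filterS2 xU1 xU2 => xi Uxi hxi z.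
have [zT|/ltW zT] := leP `|z| T1.
  by apply: le_trans (hxi z zT) _; rewrite ler_peMr ?lerDl// ltW.
have z0 : 0 < `|z| by apply: lt_le_trans zT.
have := UT1 xi `|z| (`|z|^-1 *: z) Uxi zT.
rewrite normrZ normfV normr_id mulVf ?gt_eqF// scalerA divff ?gt_eqF// scale1r.
move=> /(_ (lexx _)) /le_trans; apply.
by rewrite ler_pM2l// lerDr.
Qed.

(** The bound [T0] lets several directions share one large scale, so that properties of [h xi] at
    that scale pass to [hinf xi] as [e] vanishes. *)
Lemma ray_near xi z e T0 : 0 < e -> exists2 T, 1 <= T /\ T0 <= T &
  forall t, T <= t -> `|h xi (t *: z) / t - hinf xi z| <= e.
Proof.
move=> e0; have [U [T [xU T1 UT]]] := recession_near xi z e0.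
exists (Num.max T T0); first by rewrite !le_max T1 lexx orbT.
move=> t; rewrite ge_max => /andP[Tt _]; apply: UT => //; exact: nbhs_singleton.
Qed.

Lemma hinf_lipschitz C xi : is_lipschitz C (h xi) -> is_lipschitz C (hinf xi).
Proof.
move=> hC u v; apply/ler_addgt0Pr => e e0.
have e2 : 0 < e / 2 by rewrite divr_gt0.
have [T [T1 _] TP] := ray_near xi u 0 e2.
have [T' [_ TT'] T'P] := ray_near xi v T e2.
have hu := TP _ TT'; have hv := T'P _ (lexx _).
have t0 : 0 < T' by apply: lt_le_trans TT'; apply: lt_le_trans T1.
have : `|h xi (T' *: u) / T' - h xi (T' *: v) / T'| <= C * `|u - v|.
  rewrite -mulrBl normf_div (ger0_norm (ltW t0)) ler_pdivrMr//.
  apply: le_trans (hC _ _) _; rewrite -scalerBr normrZ (ger0_norm (ltW t0)).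
  by rewrite mulrCA mulrC.
move: hu hv; rewrite !ler_norml => /andP[? ?] /andP[? ?] /andP[? ?].
by apply/andP; split; lra.
Qed.

Lemma hinf_convex xi : is_convex (hinf xi).
Proof.
move=> s u v s01; apply/ler_addgt0Pr => e e0.
have e2 : 0 < e / 2 by rewrite divr_gt0.
have [T [T1 _] TP] := ray_near xi u 0 e2.
have [T' [_ TT'] T'P] := ray_near xi v T e2.
have [t [_ T't] tP] := ray_near xi (s *: u + (1 - s) *: v) T' e2.
have hu := TP _ (le_trans TT' T't); have hv := T'P _ T't; have huv := tP _ (lexx _).
have t0 : 0 < t by apply: lt_le_trans T't; apply: lt_le_trans TT'; apply: lt_le_trans T1.
have : h xi (t *: (s *: u + (1 - s) *: v)) / t <=
    s * (h xi (t *: u) / t) + (1 - s) * (h xi (t *: v) / t).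
  rewrite ler_pdivrMr// mulrDl -!mulrA mulVf ?gt_eqF// !mulr1.
  by rewrite scalerDr !scalerA ![t * _]mulrC -!scalerA; exact: h_convex.
case/andP: s01 => s0 s1.
move: hu hv huv; rewrite !ler_norml => /andP[? ?] /andP[? ?] /andP[? ?].
nra.
Qed.

Lemma hinf_homogeneous xi s z : 0 < s -> hinf xi (s *: z) = s * hinf xi z.
Proof.
move=> s0; apply/eqP; rewrite -subr_eq0 -normr_le0; apply/ler_addgt0Pr => e e0.
have e2 : 0 < e / 2 by rewrite divr_gt0.
have es : 0 < e / 2 / s by rewrite divr_gt0.
have [T _ TP] := ray_near xi z 0 es.
have [t [t1 tT] tP] := ray_near xi (s *: z) (T / s) e2.
have t0 : 0 < t by apply: lt_le_trans t1.
have hz := tP _ (lexx _); rewrite ler_pdivrMr// in tT.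
have hs : `|h xi (t *: (s *: z)) / t - s * hinf xi z| <= e / 2.
  (* Scale [t] in direction [s *: z] is scale [t * s] in direction [z]. *)
  rewrite (_ : _ - _ = (h xi ((t * s) *: z) / (t * s) - hinf xi z) * s).
    by rewrite normrM (ger0_norm (ltW s0)) -ler_pdivlMr//; exact: TP.
  by rewrite mulrBl invfM mulrA divfK ?gt_eqF// scalerA [s * _]mulrC.
move: hz hs; rewrite add0r !ler_norml => /andP[? ?] /andP[? ?].
by apply/andP; split; lra.
Qed.

Lemma hinf0 xi : hinf xi 0 = 0.
Proof.
have := @hinf_homogeneous xi 2 0 (ltr0n _ 2); rewrite scaler0; lra.
Qed.

(** Dividing by the scale removes the constant [beta - delta] in the limit and keeps the homogeneous
    terms. One slope thus serves both the oscillation and the concentration part. *)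
Lemma hinf_minorant xi a beta delta :
  (forall z, dotp a z + beta - delta * (1 + `|z|) <= h xi z) ->
  forall z, dotp a z - delta * `|z| <= hinf xi z.
Proof.
move=> ah z; apply/ler_addgt0Pr => e e0.
have e2 : 0 < e / 2 by rewrite divr_gt0.
have [t [t1 tK] tP] := ray_near xi z (`|beta - delta| / (e / 2)) e2.
have t0 : 0 < t by apply: lt_le_trans t1.
have := tP _ (lexx _); rewrite ler_norml => /andP[_ ht].
rewrite ler_pdivrMr// in tK.
have : dotp a z - delta * `|z| - e / 2 <= h xi (t *: z) / t.
  rewrite ler_pdivlMr//; apply: le_trans (ah (t *: z)).
  rewrite dotpZr normrZ (ger0_norm (ltW t0)).
  by have := ler_norm (- (beta - delta)); rewrite normrN; nra.
lra.
Qed.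

(** The estimates for [h] pass to the limit along rays: the weight [1 + t * |z|], divided by
    [t >= 1], is at most [1 + |z|]. *)
Lemma hinf_admissible : admissible hinf.
Proof.
have [C C0 hC] := uniform_lipschitz.
split; first by move=> xi; exact: lipschitz_continuous (hinf_lipschitz (hC xi)).
- exists C => xi z; have := hinf_lipschitz (hC xi) z 0.
  by rewrite hinf0 !subr0 => /le_trans; apply; rewrite ler_wpM2l// lerDr.
move=> xi0 e e0; apply: filterS (admissible_uniform h_admissible xi0 e0) => xi hxi z.
apply/ler_addgt0Pr => e' e'0.
have e2 : 0 < e' / 2 by rewrite divr_gt0.
have [T [T1 _] TP] := ray_near xi z 0 e2.
have [t [t1 Tt] tP] := ray_near xi0 z T e2.
have h1 := TP _ Tt; have h0 := tP _ (lexx _).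
have t0 : 0 < t by apply: lt_le_trans t1.
have : `|h xi (t *: z) / t - h xi0 (t *: z) / t| <= e * (1 + `|z|).
  rewrite -mulrBl normf_div (ger0_norm (ltW t0)) ler_pdivrMr//.
  apply: le_trans (hxi _) _; rewrite normrZ (ger0_norm (ltW t0)).
  rewrite -mulrA ler_pM2l// mulrDl mul1r [t * _]mulrC lerD2r//.
move: h0 h1; rewrite !ler_norml => /andP[? ?] /andP[? ?] /andP[? ?].
by apply/andP; split; lra.
Qed.

End recession.

(** * Localized Jensen inequality *)

Lemma local_minorant (R : realType) (d m : nat) (g : torus R d -> 'rV[R]_m -> R)
    xi0 z0 a beta delta eta :
  admissible g -> (forall z, dotp a z + beta <= g xi0 z) ->
  g xi0 z0 <= dotp a z0 + beta + eta -> 0 < delta -> 0 < eta ->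
  exists U B, [/\ open U /\ U xi0, open B /\ B z0,
    forall xi z, U xi -> dotp a z + beta - delta * (1 + `|z|) <= g xi z &
    forall xi z, U xi -> B z -> g xi z <= dotp a z + beta + 2 * eta].
Proof.
move=> ag ga gz0 delta0 eta0.
have z2 : 0 < 2 + `|z0| by rewrite ltr_pwDl.
(* Varying [xi], varying [z] in [g xi0] and varying [z] in the affine function cost [eta / 4] each;
   with the initial [eta] the total stays below [2 * eta]. *)
pose e := Num.min delta (eta / 4 / (2 + `|z0|)).
have e0 : 0 < e by rewrite lt_min delta0 /= !divr_gt0.
have edelta : e <= delta by rewrite ge_min lexx.
have eeta : e * (2 + `|z0|) <= eta / 4.
  by rewrite -ler_pdivlMr// ge_min lexx orbT.
have : nbhs xi0 [set xi | forall z, `|g xi z - g xi0 z| <= e * (1 + `|z|)].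
  exact: (admissible_uniform ag xi0 e0).
rewrite nbhsE => -[U oU UP].
have e4 : 0 < eta / 4 by rewrite divr_gt0.
have : nbhs z0 [set z | [/\ `|z| <= `|z0| + 1, g xi0 z <= g xi0 z0 + eta / 4 &
    dotp a z0 <= dotp a z + eta / 4]].
  have n1 : \forall z \near z0, `|z| <= `|z0| + 1.
    apply: filterS (nbhsx_ballx z0 1 ltr01) => z; rewrite -ball_normE /= => /ltW zz.
    by rewrite -lerBlDl (le_trans (lerB_dist _ _))// distrC.
  have n2 : \forall z \near z0, g xi0 z <= g xi0 z0 + eta / 4.
    have /cvgrPdist_le/(_ _ e4) := @admissible_continuous _ _ _ _ ag xi0 z0.
    by apply: filterS => z; rewrite ler_norml => /andP[+ _]; lra.
  have n3 : \forall z \near z0, dotp a z0 <= dotp a z + eta / 4.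
    have /cvgrPdist_le/(_ _ e4) := @dotp_continuous _ _ a z0.
    by apply: filterS => z; rewrite ler_norml => /andP[_] /=; lra.
  by apply: filterS3 n1 n2 n3 => z.
rewrite nbhsE => -[B oB BP]; exists U, B; split.
- by case: oU.
- by case: oB.
- move=> xi z Uxi; have := UP _ Uxi z; rewrite ler_norml => /andP[+ _].
  have := ga z; have : e * (1 + `|z|) <= delta * (1 + `|z|).
    by rewrite ler_wpM2r// addr_ge0.
  by lra.
- move=> xi z Uxi /BP[z1 gz az].
  have := UP _ Uxi z; rewrite ler_norml => /andP[_].
  have : e * (1 + `|z|) <= e * (2 + `|z0|) by rewrite ler_pM2l//; lra.
  by lra.
Qed.

Section localization.
Context (R : realType) (d m : nat).
Local Notation Z := (torus R d).
Local Notation E := 'rV[R]_m.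
Variables (ref : {measure set Z -> \bar R}) (bary : set Z -> E)
  (baryg : set Z -> R) (M : set Z -> R) (G : set Z) (g : Z -> E -> R)
  (b : Z -> E) (c : Z -> R).
Hypothesis ref_finite : (ref setT < +oo)%E.
Hypothesis bary0 : bary set0 = 0.
Hypothesis baryg0 : baryg set0 = 0.
Hypothesis M_ge0 : forall V, measurable V -> 0 <= M V.
Hypothesis M_additive : forall V W, measurable V -> measurable W ->
  [disjoint V & W] -> M (V `|` W) = M V + M W.
Hypothesis G_measurable : measurable G.
Hypothesis G_full : ref (~` G) = 0%E.
Hypothesis b_density : rn_density_rV ref bary b.
Hypothesis c_density : rn_density ref baryg c.
(** Both inequalities of the theorem supply such a bound, with [G] the whole torus for the Lebesgue
    density and a Lebesgue null set carrying [rho_s] for the singular one. *)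
Hypothesis g_minorant : forall xi0 z0 delta eta, 0 < delta -> 0 < eta ->
  exists a beta U B, [/\ open U /\ U xi0, open B /\ B z0,
    forall V, measurable V -> V `<=` U `&` G ->
      dotp a (bary V) + beta * fine (ref V) - delta * M V <= baryg V &
    forall xi z, U xi -> B z -> g xi z <= dotp a z + beta + eta].

Let ref_fin V : measurable V -> ref V \is a fin_num.
Proof.
move=> mV; rewrite ge0_fin_numE// (le_lt_trans _ ref_finite)//.
by apply: le_measure; rewrite ?inE.
Qed.

(** One null set gathers the complement of [G] and the sets carrying the singular parts of [bary]
    and [baryg]; away from it both are integrals of their densities. *)
Let exceptional : exists N, [/\ measurable N, ref N = 0%E, ~` G `<=` N &
  forall V, measurable V -> V `&` N = set0 ->
    bary V = \row_i \int[ref]_(xi in V) b xi ord0 i /\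
    baryg V = \int[ref]_(xi in V) c xi].
Proof.
have /choice[Nb NbP] : forall i, exists N, [/\ measurable N, ref N = 0%E &
    forall V, measurable V -> bary V ord0 i =
      \int[ref]_(t in V) b t ord0 i + bary (V `&` N) ord0 i].
  by move=> i; have [_] := b_density i.
have [_ [Nc [mNc Nc0 NcP]]] := c_density.
pose Nbs := \big[setU/set0]_i Nb i.
have [mNbs Nbs0] : measurable Nbs /\ ref Nbs = 0%E.
  apply: (big_ind (fun A => measurable A /\ ref A = 0%E)); first by rewrite measure0.
    move=> A B [mA A0] [mB B0]; split; first exact: measurableU.
    by rewrite null_set_setU.
  by move=> i _; have [] := NbP i.
have mGC := measurableC G_measurable.
exists (Nbs `|` Nc `|` ~` G); split.
- by do 2 apply: measurableU => //.
- by do 2 (rewrite null_set_setU//; try exact: measurableU).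
- by move=> xi Gxi; right.
move=> V mV VN.
have VS A : A `<=` Nbs `|` Nc `|` ~` G -> V `&` A = set0.
  by move=> AN; apply/seteqP; split=> // xi [Vxi /AN Axi]; rewrite -VN.
split; last by rewrite NcP// VS ?baryg0 ?addr0// => xi; left; right.
apply/rowP => i; have [_ _ ->//] := NbP i; rewrite VS.
  by rewrite bary0 !mxE addr0.
by move=> xi Nxi; left; left; rewrite /Nbs (bigD1 i)//=; left.
Qed.

Lemma rn_density_minorant : {ae ref, forall xi, g xi (b xi) <= c xi}.
Proof.
have [N [mN N0 GN NP]] := exceptional.
have ib i : ref.-integrable setT (EFin \o (fun xi => b xi ord0 i)).
  by have [] := b_density i.
have [ic _] := c_density.
have mb : measurable_fun setT b.
  apply: measurable_coordP => i j; rewrite ord1.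
  apply/measurable_EFinP; exact: measurable_int (ib j).
have mc : measurable_fun setT c by apply/measurable_EFinP; exact: measurable_int ic.
have M_le V : measurable V -> M V <= M setT.
  move=> mV; rewrite -(setvU V) setUC M_additive//; last 2 first.
  - exact: measurableC.
  - by apply/disj_setPS => xi [].
  by rewrite lerDl M_ge0//; exact: measurableC.
(* Asking the estimate of every measurable subset makes it stable under unions, by splitting the
   subset and using additivity of [M]. *)
pose hereditary delta eta W := forall V, measurable V -> V `<=` W ->
  eta * fine (ref V) <= delta * M V.
have cover (r delta eta : R) : 0 < delta -> 0 < eta ->
    exists W, [/\ measurable W, hereditary delta eta W & forall xi, ~ N xi ->
      `|b xi| <= r -> c xi < g xi (b xi) - 2 * eta -> W xi].
  move=> delta0 eta0.
  pose P (S : set (Z * E)) := exists W, [/\ measurable W, hereditary delta eta W &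
    forall xi, ~ N xi -> S (xi, b xi) -> c xi < g xi (b xi) - 2 * eta -> W xi].
  suff [W [mW hW WP]] : P (setT `*` [set z | `|z| <= r]).
    by exists W; split => // xi Nxi br; apply: WP.
  apply: compact_set_ind.
  - by apply: compact_setX; [exact: torus_compact|exact: compact_norm_le].
  - exists set0; split=> // V mV; rewrite subset0 => ->.
    by rewrite measure0 mulr0 mulr_ge0 ?M_ge0// ltW.
  - by move=> A B AB [W [mW hW WP]]; exists W; split => // xi Nxi /AB; exact: WP.
  - move=> A B [W [mW hW WP]] [W' [mW' hW' WP']].
    exists (W `|` W'); split; first exact: measurableU.
      move=> V mV VW; have mVW := measurableI _ _ mV mW.
      have mVDW := measurableD mV mW.
      have dV : [disjoint V `&` W & V `\` W].
        by apply/disj_setPS => xi [[_ ?] [_]].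
      rewrite -(setUIDK V W) M_additive// measureU//; last exact/disj_set2P.
      rewrite fineD ?ref_fin// !mulrDr lerD//; first by apply: hW => //; exact: subIsetr.
      by apply: hW' => // xi [/VW[]].
    by move=> xi Nxi [Axi|Bxi] cxi; [left; exact: WP|right; exact: WP'].
  move=> [xi0 z0] _; have [a [beta [U [B [[oU Uxi0] [oB Bz0] minV gl]]]]] :=
    g_minorant xi0 z0 delta0 eta0.
  exists (U `*` B).
    by exists (U, B) => //; split; apply: open_nbhs_nbhs.
  (* Integrating the upper bound on [c] over a subset [V] and comparing with the lower bound on
     [baryg V] leaves [eta * fine (ref V) <= delta * M V]. *)
  exists ([set xi | c xi < dotp a (b xi) + beta - eta] `&`
    ((U `&` b @^-1` B) `&` ~` N)); split.
  - apply: measurableI.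
      have mlt : measurable_fun setT (fun xi => c xi < dotp a (b xi) + beta - eta).
        apply: measurable_fun_ltr => //; apply: measurable_funB => //.
        apply: measurable_funD => //.
        apply: (@measurableT_comp _ _ _ _ _ _ (dotp a)) => //.
        by apply: continuous_measurable_rV; exact: dotp_continuous.
      by have := mlt measurableT [set true] I; rewrite setTI.
    apply: measurableI; last exact: measurableC.
    apply: measurableI; first exact: torus_measurable_open.
    by rewrite -[X in measurable X]setTI; apply: mb => //; exact: borel_open.
  - move=> V mV VW.
    have VN0 : V `&` N = set0 by apply/seteqP; split => // xi [/VW[_ [_ Nxi]]].
    have VUG : V `<=` U `&` G.
      by move=> xi /VW[_ [[Uxi _] Nxi]]; split=> //; apply: contrapT => /GN.
    have := minV V mV VUG; have [-> ->] := NP V mV VN0.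
    have i0 := finite_integrable_cst ref_finite 0.
    have [iA EA] := Rintegral_affine ref_finite a (beta - eta) 0 mV ib i0.
    have : \int[ref]_(xi in V) c xi <=
      \int[ref]_(xi in V) (dotp a (\row_i b xi ord0 i) + (beta - eta) - 0 * 0).
      apply: le_Rintegral => //; [exact: integrableS ic|exact: integrableS iA|].
      move=> xi /VW[/ltW + _]; rewrite mul0r subr0 addrA (_ : \row_i _ = b xi)//.
      by apply/rowP => i; rewrite mxE.
    rewrite EA mul0r subr0 mulrBl; lra.
  - move=> xi Nxi [/= Uxi Bxi] cxi; split=> //=.
    by have := gl _ _ Uxi Bxi; lra.
pose bad (k : nat) := [set xi | [/\ ~ N xi, `|b xi| <= k%:R &
  c xi < g xi (b xi) - 2 * k.+1%:R^-1]].
have n1_gt0 k : 0 < k.+1%:R^-1 :> R by rewrite invr_gt0.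
have bad0 k : ref.-negligible (bad k).
  have /choice[W WP] : forall n, exists W, [/\ measurable W,
      hereditary n.+1%:R^-1 k.+1%:R^-1 W & forall xi, ~ N xi ->
      `|b xi| <= k%:R -> c xi < g xi (b xi) - 2 * k.+1%:R^-1 -> W xi].
    by move=> n; exact: cover.
  have mW : measurable (\bigcap_n W n).
    by apply: bigcap_measurableType => n _; have [] := WP n.
  exists (\bigcap_n W n); split => //; last first.
    by move=> xi [Nxi bxi cxi] n _; have [_ _] := WP n; apply.
  rewrite -[LHS]fineK ?ref_fin//; congr EFin.
  apply/eqP; rewrite eq_le fine_ge0// andbT.
  rewrite -(pmulr_rle0 _ (n1_gt0 k)); apply/ler_addgt0Pr => e e0; rewrite add0r.
  have MT : 0 <= M setT by exact: M_ge0.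
  have [n Mn] : exists n : nat, M setT / e < n%:R.
    by exists (Num.truncn (M setT / e)).+1; rewrite truncnS_gt.
  (* The intersection lies in every [W n], so [k.+1%:R^-1] times its measure is at most [M setT]
     divided by [n.+1], for every [n]. *)
  have [_ hW _] := WP n; apply: le_trans (hW _ mW (bigcap_inf _)) _ => //.
  rewrite mulrC ler_pdivrMr// (le_trans (M_le _ mW))//.
  rewrite ltr_pdivrMr// in Mn; rewrite (le_trans (ltW Mn))// mulrC ler_pM2l// ler_nat//.
have nN : ref.-negligible N by exists N; split.
have := negligibleU nN (negligible_bigcup bad0).
apply: negligibleS => xi /= /negP; rewrite -ltNge => cg.
have [Nxi|Nxi] := pselect (N xi); [by left|right].
pose D := g xi (b xi) - c xi; have D0 : 0 < D by rewrite subr_gt0.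
(* The successor of [k] exceeds both [|b xi|] and [2 / D], so the point is bad at level [k.+1]. *)
pose k := Num.truncn (`|b xi| + 2 / D); exists k.+1 => //.
have kk : `|b xi| + 2 / D < k.+1%:R by exact: truncnS_gt.
have D2 : 0 < 2 / D by rewrite divr_gt0.
split => //; first by apply: ltW; apply: le_lt_trans kk; rewrite lerDl ltW.
have : 2 / k.+2%:R < D.
  rewrite ltr_pdivrMr// mulrC -ltr_pdivrMr//.
  have : k.+1%:R < k.+2%:R :> R by rewrite ltr_nat.
  have := normr_ge0 (b xi); lra.
by rewrite /D !ltrBrDr addrC.
Qed.

End localization.

(** * Strong recession functions of integrands independent of x *)

Section recession_of_R2.
Context (R : realType) (d m : nat) (Omega : set 'rV[R]_d).
Local Notation Z := (torus R d).
Local Notation E := 'rV[R]_m.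
Variable h : Z -> E -> R.
Hypothesis h_R2 : R2 Omega (fun=> h).
Local Notation rec := (recession Omega (fun=> h)).

(** Equality of the upper and lower limits confines the quotient near [rec x xi0 z]. As [x] lies in
    the closure, some point of [Omega] is available in the first slot, on which the quotient does
    not depend. *)
Lemma R2_recession_near x : closure Omega x -> forall (xi0 : Z) (z : E) (e : R),
  0 < e -> \forall xi \near xi0 & t \near +oo, `|h xi (t *: z) / t - rec x xi0 z| <= e.
Proof.
move=> cx xi0 z e e0; have [up lo] := h_R2.2 x xi0 z cx.
set l := rec x xi0 z in up lo *; set F := recession_filter Omega x xi0.
pose q := recession_quotient (fun=> h) z : 'rV[R]_d * Z * R -> R.
have FF : Filter F by apply: filter_prod_filter.
have [A FA Aq] : exists2 A, F A & forall p, A p -> q p <= l + e.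
  have : (upper_recession Omega (fun=> h) x xi0 z < (l + e)%:E)%E.
    by rewrite up lte_fin ltrDl.
  rewrite /upper_recession limf_esupE => /ereal_inf_lt[_ [A FA <-] Ale].
  exists A => // p Ap; rewrite -lee_fin; apply: le_trans (ltW Ale).
  by apply: ereal_sup_ubound; exists p.
have [B FB Bq] : exists2 B, F B & forall p, B p -> l - e <= q p.
  have : ((l - e)%:E < lower_recession Omega (fun=> h) x xi0 z)%E.
    by rewrite lo lte_fin ltrBlDr ltrDl.
  rewrite /lower_recession limf_einfE => /ereal_sup_gt[_ [B FB <-] Ble].
  exists B => // p Bp; rewrite -lee_fin; apply: le_trans (ltW Ble) _.
  by apply: ereal_inf_lbound; exists p.
have [[P W] /= [[[S U] /= [xS xU] SUP] oW] PWAB] := filterI FA FB.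
have [y [Oy Sy]] : Omega `&` [set y | Omega y -> S y] !=set0 by exact: cx.
exists (U, W) => //= -[xi t] /= [Uxi Wt].
have [|Ap Bp] := PWAB ((y, xi), t).
  by split => //=; apply: SUP; split => //=; exact: Sy.
have := Aq _ Ap; have := Bq _ Bp; rewrite /q /recession_quotient /= => *.
by rewrite ler_norml; apply/andP; split; lra.
Qed.

Lemma recession_indep x y xi z : closure Omega x -> closure Omega y ->
  rec x xi z = rec y xi z.
Proof.
move=> cx cy; apply/eqP; rewrite -subr_eq0 -normr_le0; apply/ler_addgt0Pr => e e0.
have e2 : 0 < e / 2 by rewrite divr_gt0.
have [T [T1 _] TP] := ray_near (R2_recession_near cx) xi z 0 e2.
have [t [_ Tt] tP] := ray_near (R2_recession_near cy) xi z T e2.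
have := TP _ Tt; have := tP _ (lexx _).
rewrite add0r !ler_norml => /andP[? ?] /andP[? ?].
by apply/andP; split; lra.
Qed.

(** Homogeneity reduces the recession quotient to [rec x xi' z], which tends to [rec x xi z]. This
    identifies the concentration integrand of [barycenter_of] when it is applied to the recession
    function. *)
Lemma recession_idem x xi z : closure Omega x -> admissible (rec x) ->
  recession Omega rec x xi z = rec x xi z.
Proof.
move=> cx arec.
have wP : ProperFilter (within Omega (nbhs x)) by exact: within_nbhs_proper.
rewrite {1}/recession.
have FF : ProperFilter (recession_filter Omega x xi).
  by apply: filter_prod_proper; exact: pinfty_nbhs_properfilter.
apply: cvg_lim => //; apply/cvgrPdist_le => e e0.
have z1 : 0 < 1 + `|z| by rewrite ltr_pwDl.
have ez : 0 < e / (1 + `|z|) by rewrite divr_gt0.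
exists (Omega `*` [set xi' | forall w, `|rec x xi' w - rec x xi w| <=
   e / (1 + `|z|) * (1 + `|w|)], [set t | 0 < t]) => /=.
  split; last by exists 0; split; [exact: num_real|].
  exists (Omega, [set xi' | forall w, `|rec x xi' w - rec x xi w| <=
   e / (1 + `|z|) * (1 + `|w|)]) => //=; split; first exact: withinT.
  exact: (admissible_uniform arec xi ez).
move=> [[y xi'] t] /= [[Oy xi'P] t0]; rewrite /recession_quotient /=.
rewrite (@recession_indep y x)//; last exact: subset_closure.
rewrite (hinf_homogeneous (R2_recession_near cx))// mulrAC divff ?gt_eqF// mul1r.
by rewrite distrC (le_trans (xi'P z))// divfK// gt_eqF.
Qed.

End recession_of_R2.

(** * Barycenters weighted by a density value *)

Section scaled_kernel.
Context (R : realType) (d m : nat).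
Local Notation Z := (torus R d).
Local Notation E := 'rV[R]_m.
Variables (mu : probability Z R) (kappa : Z -> probability E R) (alpha : R).
Hypothesis alpha_ge0 : 0 <= alpha.
Hypothesis kappa_weakstar :
  0 < alpha -> weakstar_measurable mu setT (C0 R E) kappa.
Hypothesis kappa_moment : (\int[mu]_t \int[kappa t]_z (enorm z)%:E < +oo)%E.

Definition kernel_mean (V : set Z) : E :=
  \row_i \int[mu]_(xi in V) (\int[kappa xi]_z z ord0 i).

(** Scaled by [alpha], this enters the finite measure that absorbs the errors
    [delta * (1 + |z|)]. *)
Definition kernel_mass (V : set Z) : R :=
  \int[mu]_(xi in V) (\int[kappa xi]_z (1 + `|z|)).

Lemma kernel_mass_ge0 V : 0 <= alpha * kernel_mass V.
Proof.
rewrite mulr_ge0//; apply: Rintegral_ge0 => xi _.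
by apply: Rintegral_ge0 => z _; rewrite addr_ge0.
Qed.

Lemma kernel_mass_additive V W : measurable V -> measurable W ->
  [disjoint V & W] ->
  alpha * kernel_mass (V `|` W) = alpha * kernel_mass V + alpha * kernel_mass W.
Proof.
(* Both sides vanish with [alpha]; otherwise the kernel is known to be weak-* measurable. *)
move=> mV mW VW; have [->|a0] := eqVneq alpha 0; first by rewrite !mul0r addr0.
have {}a0 : 0 < alpha by rewrite lt_neqAle eq_sym a0.
have [w iw nw] := ae_integrable_admissible (kappa_weakstar a0) kappa_moment
  (linear_growth_admissible d (@linear_growth_norm1 R m)).
rewrite -mulrDr /kernel_mass !(eq_Rintegral_ae _ nw) Rintegral_setU//.
by apply: integrableS iw => //; exact: measurableU.
Qed.

Lemma le_affine_scaled_kernel g (V : set Z) (a : E) (beta delta : R) :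
  admissible g -> measurable V ->
  (forall xi z, V xi -> dotp a z + beta - delta * (1 + `|z|) <= g xi z) ->
  alpha * dotp a (kernel_mean V) + alpha * (beta * fine (mu V)) -
    delta * (alpha * kernel_mass V) <=
  alpha * \int[mu]_(xi in V) (\int[kappa xi]_z g xi z).
Proof.
move=> ag mV Vg; have [->|a0] := eqVneq alpha 0.
  by rewrite !mul0r mulr0 addr0 subr0.
have {}a0 : 0 < alpha by rewrite lt_neqAle eq_sym a0.
have := le_affine_Rintegral_kernel (kappa_weakstar a0) kappa_moment ag mV Vg.
by rewrite -(ler_pM2l a0) mulrBr mulrDr [alpha * (delta * _)]mulrCA.
Qed.

End scaled_kernel.

(** Each measure is concentrated on the unit sphere, so every inner integral equals one. *)
Lemma sphere_moment (R : realType) (d m : nat) (mu : probability (torus R d) R)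
    (kappa : torus R d -> probability 'rV[R]_m R) :
  (forall xi, kappa xi [set z | enorm z = 1] = 1%E) ->
  (\int[mu]_t \int[kappa t]_z (enorm z)%:E < +oo)%E.
Proof.
move=> sph.
have mS : measurable [set z : 'rV[R]_m | enorm z = 1].
  have := @measurable_enorm R m measurableT [set 1] (measurable_set1 _).
  by rewrite setTI.
have -> : (\int[mu]_t \int[kappa t]_z (enorm z)%:E = \int[mu]_t cst 1 t)%E.
  apply: eq_integral => xi _ /=.
  rewrite (@eq_integral_off_null _ _ _ (kappa xi) (~` [set z | enorm z = 1]) setT
    _ (cst 1%E)) ?integral_cst//=.
  - by rewrite (@probability_setT _ _ _ (kappa xi)) mul1e.
  - exact: measurableC.
  - by rewrite (@probability_setC _ _ _ (kappa xi))// sph subee.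
  - by move=> z _ /contrapT /= ->.
rewrite integral_cst// mul1e.
by apply: le_lt_trans (ltry 1); exact: (probability_le1 mu measurableT).
Qed.

Theorem proposition6p2 (R : realType) (d m l k : nat) (d_gt0 : (0 < d)%N)
  (p : R) (p_gt1 : 1 < p) (p_lt : p * (d%:R - 1) < d%:R)
  (Omega : set 'rV[R]_d) (Omega_open : open Omega)
  (Omega_bounded : bounded_set Omega)
  (Omega_boundary : lebesgue_rV R d (closure Omega `\` Omega) = 0%E)
  (A : multiindex d k -> 'M[R]_(m, l))
  (nu : young_tuple R d m) (nu_Y2 : Y2 Omega nu)
  (nu_A_free : A_free Omega A p nu)
  (h : torus R d -> 'rV[R]_m -> R)
  (h_continuous : continuous (fun q : torus R d * 'rV[R]_m => h q.1 q.2))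
  (h_R2 : R2 Omega (fun=> h))
  (h_convex : forall xi, convex_function [set: 'rV[R]_m] (h xi))
  (lac : 'rV[R]_d -> R) (ls : {finite_measure set 'rV[R]_d -> \bar R})
  (lambda_decomposition :
    lebesgue_decomposition (lebesgue_rV R d) (conc nu) lac ls)
  (x : 'rV[R]_d) (x_regular : regular_point Omega ls x)
  (x_defined : barycenter_defined nu lac x) :
  (forall (b : torus R d -> 'rV[R]_m) (c : torus R d -> R),
    rn_density_rV (@lebesgue_torus R d) (barycenter nu lac x) b ->
    rn_density (@lebesgue_torus R d)
      (barycenter_of Omega (fun=> h) nu lac x) c ->
    {ae @lebesgue_torus R d, forall xi, h xi (b xi) <= c xi}) /\
  (forall (r : torus R d -> R) (rho_s : {measure set (torus R d) -> \bar R}),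
    lebesgue_decomposition (@lebesgue_torus R d) (conc_scale nu x) r rho_s ->
    forall (b : torus R d -> 'rV[R]_m) (c : torus R d -> R),
    rn_density_rV rho_s (barycenter nu lac x) b ->
    rn_density rho_s
      (barycenter_of Omega (recession Omega (fun=> h)) nu lac x) c ->
    {ae rho_s, forall xi, recession Omega (fun=> h) x xi (b xi) <= c xi}).
Proof.
have [cx _] := x_regular; have [nu_ws nu_mom kappa_ws] := x_defined.
have [_ lac_ge0 _ _] := lambda_decomposition.
have kappa_mom := sphere_moment (conc_scale nu x)
  (fun xi => conc_angle_sphere nu_Y2 xi cx).
pose hinf := recession Omega (fun=> h) x.
have h_rec := R2_recession_near h_R2 cx.
have {}h_convex xi := convex_functionP (h_convex xi).
have ah : admissible h := h_admissible h_continuous h_convex h_rec.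
have ahinf : admissible hinf := hinf_admissible h_continuous h_convex h_rec.
have [C _ hC] := uniform_lipschitz h_continuous h_convex h_rec.
pose al := lac x; have al_ge0 : 0 <= al := lac_ge0 x.
pose L := kernel_mean (@lebesgue_torus R d) (osc nu x).
pose K := kernel_mean (conc_scale nu x) (conc_angle nu x).
have baryE V : barycenter nu lac x V = L V + al *: K V.
  by apply/rowP => i; rewrite !mxE.
have mean0 (mu : probability (torus R d) R) kappa :
    @kernel_mean R d m mu kappa set0 = 0.
  by apply/rowP => i; rewrite !mxE Rintegral_set0.
have bary0 : barycenter nu lac x set0 = 0.
  by rewrite baryE /L /K !mean0 scaler0 addr0.
have baryg0 g : barycenter_of Omega g nu lac x set0 = 0.
  by rewrite /barycenter_of !Rintegral_set0 mulr0 addr0.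
pose ML := kernel_mass (@lebesgue_torus R d) (osc nu x).
pose MK := kernel_mass (conc_scale nu x) (conc_angle nu x).
have ML_ge0 V : 0 <= ML V.
  by have := kernel_mass_ge0 (@lebesgue_torus R d) (osc nu x) ler01 V; rewrite mul1r.
have MK_ge0 V : 0 <= al * MK V by exact: kernel_mass_ge0.
split=> [b c b_density c_density|
  r rho_s [_ r_ge0 [N0 [mN0 N00 rhoN0]] rhoE] b c b_density c_density].
(* The error measure adds the oscillation mass and the weighted concentration mass, and [G] is the
   whole torus. *)
- apply: (@rn_density_minorant _ _ _ _ _ _ (fun V => ML V + al * MK V) setT
    _ _ _ _ bary0 (baryg0 _) _ _ _ _ b_density c_density) => //.
  + exact: (le_lt_trans (probability_le1 (@lebesgue_torus R d) measurableT) (ltry 1)).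
  + by move=> V mV; rewrite addr_ge0.
  + move=> V W mV mW VW.
    rewrite /MK (kernel_mass_additive al_ge0 kappa_ws kappa_mom)//.
    have := kernel_mass_additive ler01 (fun=> nu_ws) nu_mom mV mW VW.
    by rewrite !mul1r addrACA => <-.
  + by rewrite setCT measure0.
  move=> xi0 z0 delta eta delta0 eta0.
  (* Half of [eta] is spent here because [local_minorant] doubles it. *)
  have eta2 : 0 < eta / 2 by rewrite divr_gt0.
  have [a [beta [ale alz]]] := affine_minorant z0 (h_convex xi0) (hC xi0) eta2.
  have [U [B [oU oB Uh UBh]]] := local_minorant ah ale alz delta0 eta2.
  exists a, beta, U, B; split => //; last first.
    by move=> xi z Uxi Bz; have := UBh _ _ Uxi Bz; rewrite mulrC divfK.
  move=> V mV; rewrite setIT => VU.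
  have Vh xi z : V xi -> dotp a z + beta - delta * (1 + `|z|) <= h xi z.
    by move=> /VU; exact: Uh.
  (* The same slope bounds the recession function with zero constant, so [beta] is weighted by
     Lebesgue measure alone. *)
  have Vhinf xi z : V xi -> dotp a z + 0 - delta * (1 + `|z|) <= hinf xi z.
    move=> Vxi; have := hinf_minorant h_rec (Vh xi ^~ Vxi) z.
    by apply: le_trans; rewrite addr0 lerD2l lerN2 ler_pM2l// lerDr.
  have lL := le_affine_scaled_kernel ler01 (fun=> nu_ws) nu_mom ah mV Vh.
  have lK := le_affine_scaled_kernel al_ge0 kappa_ws kappa_mom ahinf mV Vhinf.
  rewrite !mul1r in lL; rewrite mul0r mulr0 addr0 in lK.
  rewrite baryE dotpDr dotpZr /barycenter_of -/al.
  move: lL lK; rewrite -/L -/K -/ML -/MK /hinf; lra.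
- have rho1 : (rho_s setT < +oo)%E.
    apply: (@le_lt_trans _ _ (conc_scale nu x setT)); last first.
      exact: (le_lt_trans (probability_le1 (conc_scale nu x) measurableT) (ltry 1)).
    by rewrite rhoE// leeDr// integral_ge0// => xi _; rewrite lee_fin.
  (* [N0] carries [rho_s] and is Lebesgue null, so only the concentration mass enters the error. *)
  apply: (@rn_density_minorant _ _ _ _ _ _ (fun V => al * MK V) N0
    _ _ _ rho1 bary0 (baryg0 _) _ _ _ _ b_density c_density) => //.
    by move=> V W mV mW VW; rewrite /MK (kernel_mass_additive al_ge0 kappa_ws kappa_mom).
  move=> xi0 z0 delta eta delta0 eta0.
  have eta2 : 0 < eta / 2 by rewrite divr_gt0.
  have [a [beta [ale alz]]] := affine_minorant z0
    (hinf_convex h_convex h_rec xi0) (hinf_lipschitz h_rec (hC xi0)) eta2.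
  (* The constant is nonpositive because [hinf] vanishes at the origin. Replacing it by zero
     therefore keeps the near-equality at [z0], and homogeneity keeps the minorant. *)
  have beta_le0 : beta <= 0.
    have := ale 0; rewrite (hinf0 h_rec) -(scale0r (0 : 'rV[R]_m)) dotpZr; lra.
  have {}ale z : dotp a z + 0 <= hinf xi0 z.
    apply/ler_addgt0Pr => e e0; rewrite addr0.
    (* Dilating [z] by this factor and dividing by it afterwards reduces the contribution of [beta]
       below [e]. *)
    have t0 : 0 < (`|beta| + 1) / e by rewrite divr_gt0// ltr_pwDr.
    have := ale (((`|beta| + 1) / e) *: z).
    rewrite dotpZr (hinf_homogeneous h_rec)// => H.
    rewrite -(ler_pM2l t0) mulrDr divfK ?gt_eqF//.
    by have := ler_norm (- beta); rewrite normrN /hinf; lra.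
  have {}alz : hinf xi0 z0 <= dotp a z0 + 0 + eta / 2 by rewrite /hinf; lra.
  have [U [B [oU oB Uh UBh]]] := local_minorant ahinf ale alz delta0 eta2.
  exists a, 0, U, B; split => //; last first.
    by move=> xi z Uxi Bz; have := UBh _ _ Uxi Bz; rewrite mulrC divfK.
  move=> V mV VU.
  (* Subsets of [N0] are Lebesgue null, so the oscillation part of both barycenters vanishes on
     [V]. *)
  have V0 : @lebesgue_torus R d V = 0%E.
    by apply: (subset_measure0 mV mN0 _ N00) => xi /VU[].
  have Vhinf xi z : V xi -> dotp a z + 0 - delta * (1 + `|z|) <= hinf xi z.
    by move=> /VU[Uxi _]; exact: Uh.
  have lK := le_affine_scaled_kernel al_ge0 kappa_ws kappa_mom ahinf mV Vhinf.
  rewrite mul0r mulr0 addr0 in lK.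
  have LV : L V = 0 by apply/rowP => i; rewrite !mxE Rintegral_null.
  rewrite baryE LV add0r dotpZr mul0r addr0 /barycenter_of Rintegral_null// add0r.
  apply: le_trans lK _; rewrite -/al ler_wpM2l// le_eqVlt; apply/orP; left.
  apply/eqP; apply: eq_Rintegral => xi _; apply: eq_Rintegral => z _.
  by rewrite recession_idem.
Qed.
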